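(* Let $\mathrm{D}\subset\mathbb{R}^d$, $d\geq 2$, be a bounded, polytopal domain. For every regular, simplicial triangulation $\mathcal{T}$ of $\mathrm{D}$ and every discretization space $\mathbb{W}\in\{\mathbb{V}_\bullet^{(1)},\mathbb{V}_\bullet^{(2)},\mathbb{V}_\bullet^{(3)},\mathbb{V}_\bullet^{(4)}\}$ on $\mathcal{T}$ (with $\mathbb{V}_\bullet^{(3)}$ excluded if $d>3$, and with $\mathbb{V}_\bullet^{(4)}$ considered when $\mathrm{D}$ is a space-time cylinder), with Cartesian product structure $\mathbb{W}=\mathbb{W}_1\times\dots\times\mathbb{W}_m$, shape functions $\{\theta^{\mathbb{W}}_i\}_{i\in\mathcal{I}}$ and corresponding index set $\mathcal{I}\in\{\mathcal{I}^{(1)},\mathcal{I}^{(2)},\mathcal{I}^{(3)},\mathcal{I}^{(4)}\}$, respectively, the following holds. (i) There exists a neural network $\Phi^{\mathbb{W}}=\Phi^{\mathbb{W}(\mathcal{T},\mathrm{D})}$ with ReLU and BiSU activations which in parallel emulates the shape functions $\{\theta^{\mathbb{W}}_i\}_{i\in\mathcal{I}}$, that is, its realization $\mathrm{R}(\Phi^{\mathbb{W}})$ on $\mathrm{D}$, with components (blocks) indexed by $i\in\mathcal{I}$, satisfies $$\mathrm{R}(\Phi^{\mathbb{W}})(x)_i=\theta^{\mathbb{W}}_i(x)\quad\text{for a.e. } x\in\mathrm{D}\text{ and all } i\in\mathcal{I}.$$ There exists $C>0$ independent of $d$ and $\mathcal{T}$ such that $$L(\Phi^{\mathbb{W}})=5,\qquad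 M(\Phi^{\mathbb{W}})\leq C d^2\sum_{i\in\mathcal{I}}s(i)\leq C d^2\,\mathfrak{s}(\mathcal{I})\dim(\mathbb{W}(\mathcal{T},\mathrm{D})).$$ (ii) For $\mathbb{W}\in\{\mathbb{V}_\bullet^{(1)},\mathbb{V}_\bullet^{(2)},\mathbb{V}_\bullet^{(3)}\}$ and for every finite element function $v\in\mathbb{W}(\mathcal{T},\mathrm{D})$ with components $v_{(k)}=\sum_{i=(j,k)\in\mathcal{I}}v_i\theta^{\mathbb{W}}_i\in\mathbb{W}_k(\mathcal{T},\mathrm{D})$ for all $k=1,\dots,m$, there exists a neural network $\Phi^{\mathbb{W},v}=\Phi^{\mathbb{W}(\mathcal{T},\mathrm{D}),v}$ with ReLU and BiSU activations such that, for a constant $C>0$ independent of $d$ and $\mathcal{T}$, $$\mathrm{R}(\Phi^{\mathbb{W},v})_k(x)=v_{(k)}(x)\quad\text{for a.e. } x\in\mathrm{D}\text{ and all }k=1,\dots,m,$$ $$L(\Phi^{\mathbb{W},v})=5,\qquad M(\Phi^{\mathbb{W},v})\leq C d^2\sum_{i\in\mathcal{I}}s(i)\leq C d^2\,\mathfrak{s}(\mathcal{I})\dim(\mathbb{W}(\mathcal{T},\mathrm{D})).$$ (iii) The layer dimensions and the lists of activation functions of $\Phi^{\mathbb{W}}$ and $\Phi^{\mathbb{W},v}$ are independent of $v$ and depend on $\mathcal{T}$ only through $\{s(i)\}_{i\in\mathcal{I}}$ and $|\mathcal{I}|=\dim(\mathbb{W}(\mathcal{T},\mathrm{D}))$. (iv)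 For each $\mathbb{W}\in\{\mathbb{V}_\bullet^{(1)},\mathbb{V}_\bullet^{(2)},\mathbb{V}_\bullet^{(3)}\}$, the set $\mathcal{NN}(\mathbb{W};\mathcal{T},\mathrm{D}):=\{\Phi^{\mathbb{W},v}: v\in\mathbb{W}(\mathcal{T},\mathrm{D})\}$, together with the linear operation $$\Phi^{\mathbb{W},v}\,\widehat{+}\,\lambda\Phi^{\mathbb{W},w}:=\Phi^{\mathbb{W},v+\lambda w}\qquad\text{for all }v,w\in\mathbb{W}(\mathcal{T},\mathrm{D})\text{ and }\lambda\in\mathbb{R},$$ is a vector space, and $\mathrm{R}:\mathcal{NN}(\mathbb{W};\mathcal{T},\mathrm{D})\to\mathbb{W}(\mathcal{T},\mathrm{D})$ is a linear isomorphism.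
   Context: Neural networks. A neural network (NN) $\Phi$ with input dimension $d$ and depth $L\ge1$ is a finite sequence $\Phi=((A_1,b_1,\varrho_1),\dots,(A_L,b_L,\varrho_L))$ where, with $N_0:=d$ and layer dimensions $N_1,\dots,N_L\in\mathbb{N}$, $A_\ell\in\mathbb{R}^{N_\ell\times N_{\ell-1}}$, $b_\ell\in\mathbb{R}^{N_\ell}$, and $\varrho_\ell$ is a list of $N_\ell$ activation functions $\mathbb{R}\to\mathbb{R}$, applied componentwise (different nodes may have different activations). In the output layer, $\varrho_L$ is the identity. The realization is $\mathrm{R}(\Phi):\mathbb{R}^d\to\mathbb{R}^{N_L}$, $x\mapsto x_L$, with $x_0:=x$, $x_\ell:=\varrho_\ell(A_\ell x_{\ell-1}+b_\ell)$; realizations are considered on $\mathrm{D}$ and identified with elements of function spaces up to a.e. equality. The depth is $L(\Phi):=L$, and the size is $M(\Phi):=\sum_{\ell=1}^L(\|A_\ell\|_0+\|b_\ell\|_0)$, the total number of nonzero entries of all weight matrices and bias vectors. ''With ReLU and BiSU activations'' means every hidden-layer activation is either ReLU, $x\mapsto\max\{0,x\}$, or BiSU, $x\mapsto 1$ if $x>0$ and $x\mapsto0$ if $x\le0$. Triangulations. Simplices are closed. A regular, simplicial triangulation $\mathcal{T}$ of $\mathrm{D}$ is a finite set of $d$-simplices with $\overline{\mathrm{D}}=\bigcup_{K\in\mathcal{T}}K$, pairwise disjoint interiors, such that for all distinct $K,K'\in\mathcal{T}$ the intersection $K\cap K'$, if nonempty, is a common subsimplex of $K$ and $K'$. $\mathcal{V},\mathcal{E},\mathcal{F}$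 denote the sets of vertices, edges ($1$-subsimplices) and faces ($(d-1)$-subsimplices) of $\mathcal{T}$. Lowest order finite element spaces on $\mathcal{T}$. $\mathrm{S}_1$: continuous functions that are affine on each $K\in\mathcal{T}$, with shape functions the nodal hat functions indexed by $\mathcal{V}$. $\mathrm{RT}_0$: lowest order Raviart–Thomas space, i.e. vector fields in $H(\mathrm{div};\mathrm{D})$ that on each $K$ have the form $x\mapsto a+bx$, $a\in\mathbb{R}^d$, $b\in\mathbb{R}$, with the usual canonical shape functions indexed by $\mathcal{F}$ (the shape function of $f$ has nonzero constant normal component on $f$ and vanishing normal component on all other faces). $\mathrm{N}_0$ ($d\in\{2,3\}$): lowest order Nédélec space, i.e. vector fields in $H(\mathrm{curl};\mathrm{D})$ that on each $K$ have the form $x\mapsto a+Bx$, $a\in\mathbb{R}^d$, $B\in\mathbb{R}^{d\times d}$ skew-symmetric, with the usual canonical shape functions indexed by $\mathcal{E}$ (the shape function of $e$ has nonzero constant tangential component along $e$ and vanishing tangential component along all other edges). When homogeneous boundary conditions are imposed, only the shape functions of the index subset given below are kept. Product spaces. $\mathbb{W}=\mathbb{W}_1\times\dots\times\mathbb{W}_m$ with all factors on the same $\mathcal{T}$; factor $\mathbb{W}_k$ has shape functions $\{\theta^{\mathbb{W}_k}_j\}_{j\in\mathcal{I}_k}$: - $\mathbb{V}_\bullet^{(1)}=(\mathrm{S}_1\cap H^1_0(\mathrm{D}))\times\mathrm{RT}_0$: $m=2$, $\mathcal{I}_1=\mathcal{V}\cap\mathrm{D}$, $\mathcal{I}_2=\mathcal{F}$.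 - $\mathbb{V}_\bullet^{(2)}=(\mathrm{S}_1\cap H^1_0(\mathrm{D}))^d\times\mathrm{RT}_0^d$: $m=2d$, $\mathcal{I}_1=\dots=\mathcal{I}_d=\mathcal{V}\cap\mathrm{D}$, $\mathcal{I}_{d+1}=\dots=\mathcal{I}_{2d}=\mathcal{F}$. - $\mathbb{V}_\bullet^{(3)}=(\mathrm{N}_0\cap H_0(\mathrm{curl};\mathrm{D}))\times\mathrm{N}_0$: $m=2$, $\mathcal{I}_1=\{e\in\mathcal{E}: e\cap\mathrm{D}\neq\emptyset\}$, $\mathcal{I}_2=\mathcal{E}$. Here $H_0(\mathrm{curl};\mathrm{D})$ is the subspace of $H(\mathrm{curl};\mathrm{D})$ of fields with vanishing tangential trace on $\partial\mathrm{D}$. - $\mathbb{V}_\bullet^{(4)}=(\mathrm{S}_1\cap L^2(I;H^1_0(\mathrm{G})))\times\mathrm{S}_1^{n}$, where $\mathrm{D}=I\times\mathrm{G}\subset\mathbb{R}^d$ is a space-time cylinder with $I=(0,T)$, $T>0$, and $\mathrm{G}\subset\mathbb{R}^n$ a bounded polytopal domain, $d=n+1$: $m=n+1$, $\mathcal{I}_1=\mathcal{V}\cap(\overline{I}\times\mathrm{G})$, $\mathcal{I}_2=\dots=\mathcal{I}_{n+1}=\mathcal{V}$. The index set of $\mathbb{W}=\mathbb{V}_\bullet^{(\ell)}$ is $\mathcal{I}=\mathcal{I}^{(\ell)}:=\bigcup_{k=1}^m\mathcal{I}_k\times\{k\}$, and $\theta^{\mathbb{W}}_{(j,k)}:=\theta^{\mathbb{W}_k}_j$.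 Every $v\in\mathbb{W}$ has unique coefficients $(v_i)_{i\in\mathcal{I}}\subset\mathbb{R}$ such that its $k$-th component is $v_{(k)}=\sum_{j\in\mathcal{I}_k}v_{(j,k)}\theta^{\mathbb{W}_k}_j$, also written $\sum_{i=(j,k)\in\mathcal{I}}v_i\theta^{\mathbb{W}}_i$ (sum over indices with second component $k$). For $i=(j,k)\in\mathcal{I}$, $s(i):=\#\{K\in\mathcal{T}: j\subset K\}$ is the number of elements sharing the subsimplex $j$ (for a vertex $j$, the number of elements containing it), and $\mathfrak{s}(\mathcal{I}):=\max_{i\in\mathcal{I}}s(i)$. The $i$-th (resp. $k$-th) component of a realization denotes the block of output coordinates corresponding to $\theta^{\mathbb{W}}_i$ (resp. $v_{(k)}$): a single coordinate for scalar-valued functions, $d$ coordinates for vector-valued ones. *)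

(* Defs.v *)
From HB Require Import structures.
From mathcomp Require Import all_boot all_order all_algebra finmap.
From mathcomp Require Import all_classical all_reals all_analysis.

Set Implicit Arguments.
Unset Strict Implicit.
Unset Printing Implicit Defensive.

Import Order.TTheory GRing.Theory Num.Theory.
Import numFieldNormedType.Exports.

Local Open Scope classical_set_scope.
Local Open Scope ring_scope.

(* [network R q p] has input dimension p and output dimension q.  The
   activation of the output layer is the identity and is not stored. *)
Inductive network (R : Type) (q p : nat) : Type :=
| OutputLayer of 'M[R]_(q, p) & 'cV[R]_q
| HiddenLayer (r : nat) of
    'M[R]_(r, p) & 'cV[R]_r & r.-tuple (R -> R) & network R q r.

Section Networks.
Variable R : realType.

Definition relu (x : R) : R := Num.max 0 x.
Definition bisu (x : R) : R := if 0 < x then 1 else 0.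

Fixpoint realization (q p : nat) (Phi : network R q p) : 'cV[R]_p -> 'cV[R]_q :=
  match Phi with
  | OutputLayer A b => fun x => A *m x + b
  | HiddenLayer r A b rho Psi => fun x =>
      realization Psi (\col_(i < r) tnth rho i ((A *m x + b) i 0))
  end.

Fixpoint depth (q p : nat) (Phi : network R q p) : nat :=
  match Phi with
  | OutputLayer _ _ => 1
  | HiddenLayer _ _ _ _ Psi => (depth Psi).+1
  end.

Definition nnz (m n : nat) (A : 'M[R]_(m, n)) : nat :=
  #|[pred ij : 'I_m * 'I_n | A ij.1 ij.2 != 0]|.

Fixpoint nn_size (q p : nat) (Phi : network R q p) : nat :=
  match Phi with
  | OutputLayer A b => nnz A + nnz b
  | HiddenLayer _ A b _ Psi => nnz A + nnz b + nn_size Psi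
  end.

Fixpoint layer_dims (q p : nat) (Phi : network R q p) : seq nat :=
  match Phi with
  | OutputLayer _ _ => [:: q]
  | HiddenLayer r _ _ _ Psi => r :: layer_dims Psi
  end.

Fixpoint activations (q p : nat) (Phi : network R q p) : seq (seq (R -> R)) :=
  match Phi with
  | OutputLayer _ _ => [:: nseq q id]
  | HiddenLayer _ _ _ rho Psi => (rho : seq (R -> R)) :: activations Psi
  end.

Fixpoint relu_bisu (q p : nat) (Phi : network R q p) : Prop :=
  match Phi with
  | OutputLayer _ _ => True
  | HiddenLayer r _ _ rho Psi =>
      (forall i : 'I_r, tnth rho i = relu \/ tnth rho i = bisu) /\ relu_bisu Psi
  end.

Definition architecture : Type := (seq nat * seq (seq (R -> R)))%type.

Definition arch (q p : nat) (Phi : network R q p) : architecture :=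
  (layer_dims Phi, activations Phi).

(* Layer dimensions are positive integers. *)
Definition relu_bisu_network (q p : nat) (Phi : network R q p) : Prop :=
  all (ltn 0) (layer_dims Phi) /\ relu_bisu Phi.

End Networks.

Section Lebesgue.
Variable R : realType.

Definition borel_space (d : nat) := g_sigma_algebraType (@open 'cV[R]_d).

(* d-fold product of the one-dimensional Lebesgue measure, by integrating the
   measures of sections; its values matter on Borel sets only. *)
Fixpoint lebesgue (d : nat) : set 'cV[R]_d -> \bar R :=
  match d with
  | 0 => fun A => (\1_A (0 : 'cV[R]_0))%:E
  | n.+1 => fun A =>
      (\int[@lebesgue_measure R]_t
         lebesgue [set y : 'cV[R]_n | A (col_mx (t%:M : 'M[R]_1) y)])%E
  end.

Definition ae_on (d : nat) (D : set 'cV[R]_d) (P : 'cV[R]_d -> Prop) : Prop :=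
  \forall x \ae (@lebesgue d : set (borel_space d) -> \bar R), D x -> P x.

Definition ae_equal (d : nat) (X : Type) (D : set 'cV[R]_d)
    (f g : 'cV[R]_d -> X) : Prop :=
  ae_on D (fun x => f x = g x).

Definition integral_on (d : nat) (D : set 'cV[R]_d) (f : 'cV[R]_d -> R) :
    \bar R :=
  (\int[(@lebesgue d : set (borel_space d) -> \bar R)]_(x in D) (f x)%:E)%E.

Definition L2 (d : nat) (D : set 'cV[R]_d) : set ('cV[R]_d -> R) :=
  [set f | exists g : borel_space d -> R,
    [/\ ae_equal D f g, measurable_fun (D : set (borel_space d)) g &
        (@lebesgue d : set (borel_space d) -> \bar R).-integrable
          (D : set (borel_space d)) (fun x => (g x ^+ 2)%:E)]].

End Lebesgue.

Section Sobolev.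
Variables (R : realType) (d : nat).
Implicit Types (D : set 'cV[R]_d) (v : 'cV[R]_d -> 'cV[R]_d).

Definition partial (i : 'I_d) (f : 'cV[R]_d -> R) : 'cV[R]_d -> R :=
  fun x => 'D_(delta_mx i 0 : 'cV[R]_d) f x.

Definition smooth (f : 'cV[R]_d -> R) : Prop :=
  forall s : seq 'I_d, let g := foldr partial f s in
    continuous g /\
    (forall (i : 'I_d) (x : 'cV[R]_d), derivable g x (delta_mx i 0)).

Definition test_function D : set ('cV[R]_d -> R) :=
  [set phi | smooth phi /\
    exists2 A : set 'cV[R]_d, compact A /\ A `<=` D &
      forall x, ~ A x -> phi x = 0].

Definition L2_field D v : Prop := forall i : 'I_d, L2 D (fun x => v x i 0).

Definition Hdiv D : set ('cV[R]_d -> 'cV[R]_d) :=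
  [set v | L2_field D v /\
    exists2 g, L2 D g & forall phi, test_function D phi ->
      integral_on D (fun x => \sum_i v x i 0 * partial i phi x) =
      (- integral_on D (fun x => (g x * phi x)%R))%E].

(* The components of the curl are the functions d_i v_j - d_j v_i: up to sign,
   there is one of them if d = 2 and there are three if d = 3. *)
Definition Hcurl D : set ('cV[R]_d -> 'cV[R]_d) :=
  [set v | L2_field D v /\ forall i j : 'I_d,
    exists2 g, L2 D g & forall phi, test_function D phi ->
      integral_on D (fun x => v x j 0 * partial i phi x
                              - v x i 0 * partial j phi x) =
      (- integral_on D (fun x => (g x * phi x)%R))%E].

End Sobolev.

(* A closed simplex is represented by the finite set of its vertices; its
   subsimplices are the nonempty subsets of that set. *)
Notation simplex R d := {fset 'cV[R]_d}.

Section Triangulations.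
Variables (R : realType) (d : nat).
Implicit Types (D A : set 'cV[R]_d) (S K : simplex R d)
  (T : {fset simplex R d}).

Definition hull S : set 'cV[R]_d :=
  [set x | exists w : 'cV[R]_d -> R,
    [/\ forall p, p \in S -> 0 <= w p,
        \sum_(p <- S) w p = 1 & x = \sum_(p <- S) w p *: p]].

Definition affinely_independent S : Prop :=
  forall c : 'cV[R]_d -> R,
    \sum_(p <- S) c p = 0 -> \sum_(p <- S) c p *: p = 0 ->
    forall p, p \in S -> c p = 0.

(* The boundary is a finite union of polytopes, given by their vertices. *)
Definition polytopal_domain D : Prop :=
  [/\ open D, connected D, D !=set0, bounded_set D &
      exists P : {fset {fset 'cV[R]_d}},
        closure D `\` D = \bigcup_(S in [set` P]) hull S].

Definition triangulation D T : Prop :=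
  [/\ forall K, K \in T -> #|` K| = d.+1 /\ affinely_independent K,
      closure D = \bigcup_(K in [set` T]) hull K,
      forall K K', K \in T -> K' \in T -> K != K' ->
        interior (hull K) `&` interior (hull K') = set0 &
      forall K K', K \in T -> K' \in T -> K != K' ->
        hull K `&` hull K' !=set0 ->
        exists S, [/\ S != fset0, (S `<=` K)%fset, (S `<=` K')%fset &
                      hull K `&` hull K' = hull S]].

Definition subsimplices T (r : nat) : {fset simplex R d} :=
  (\bigcup_(K <- T) [fset S in fpowerset K | #|` S| == r.+1]%fset)%fset.

(* Vertices p are identified with the 0-subsimplices {p}. *)
Definition vertices T := subsimplices T 0.
Definition edges T := subsimplices T 1.
Definition faces T := subsimplices T d.-1.

(* For vertices, this is the intersection with A. *)
Definition meeting A (J : {fset simplex R d}) : {fset simplex R d} :=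
  [fset S in J | `[< (hull S `&` A !=set0)%classic >]]%fset.

Definition sharing T S : nat := 
  #|` [fset K in T | `[< (hull S `<=` hull K)%classic >]]%fset|.

End Triangulations.

Inductive fe_kind := S1 | RT0 | N0.

Definition value_dim (d : nat) (kappa : fe_kind) : nat :=
  match kappa with S1 => 1 | RT0 => d | N0 => d end.

Section FiniteElements.
Variables (R : realType) (d : nat).
Implicit Types (D : set 'cV[R]_d) (S K : simplex R d) (T : {fset simplex R d}).

Definition dot (x y : 'cV[R]_d) : R := \sum_i x i 0 * y i 0.

Definition S1_space D T : set ('cV[R]_d -> 'cV[R]_1) :=
  [set f | {within closure D, continuous f} /\
    forall K, K \in T -> exists (a : 'rV[R]_d) (b : 'cV[R]_1),
      forall x, hull K x -> f x = a *m x + b].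

Definition RT0_form (v : 'cV[R]_d -> 'cV[R]_d) : Prop :=
  exists (a : 'cV[R]_d) (b : R), forall x, v x = a + b *: x.

Definition N0_form (v : 'cV[R]_d -> 'cV[R]_d) : Prop :=
  exists (a : 'cV[R]_d) (B : 'M[R]_d), B^T = - B /\ forall x, v x = a + B *m x.

(* On each element K the field v is represented by the polynomial p K, whose
   values on the boundary of K are the traces of v from K. *)
Definition elementwise (form : ('cV[R]_d -> 'cV[R]_d) -> Prop) D T
    (v : 'cV[R]_d -> 'cV[R]_d) (p : simplex R d -> 'cV[R]_d -> 'cV[R]_d) : Prop :=
  forall K, K \in T -> form (p K) /\ ae_equal (D `&` hull K) v (p K).

Definition RT0_space D T : set ('cV[R]_d -> 'cV[R]_d) :=
  [set v | Hdiv D v /\ exists p, elementwise RT0_form D T v p].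

Definition N0_space D T : set ('cV[R]_d -> 'cV[R]_d) :=
  [set v | Hcurl D v /\ exists p, elementwise N0_form D T v p].

Definition unit_normal S (nu : 'cV[R]_d) : Prop :=
  dot nu nu = 1 /\ forall x y, x \in S -> y \in S -> dot nu (x - y) = 0.

Definition unit_tangent S (tau : 'cV[R]_d) : Prop :=
  dot tau tau = 1 /\
  exists x y (c : R), [/\ x \in S, y \in S & tau = c *: (x - y)].

(* The component in direction nu along S is equal to c from all elements
   containing S. *)
Definition component_on T (p : simplex R d -> 'cV[R]_d -> 'cV[R]_d) S
    (nu : 'cV[R]_d) (c : R) : Prop :=
  forall K, K \in T -> hull S `<=` hull K ->
    forall x, hull S x -> dot (p K x) nu = c.

Definition S1_shape D T S (f : 'cV[R]_d -> 'cV[R]_1) : Prop :=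
  S1_space D T f /\
  forall x, [fset x]%fset \in vertices T ->
    f x 0 0 = if [fset x]%fset == S then 1 else 0.

Definition RT0_shape D T S (v : 'cV[R]_d -> 'cV[R]_d) : Prop :=
  RT0_space D T v /\ exists p,
    [/\ elementwise RT0_form D T v p,
        exists nu c, [/\ unit_normal S nu, c != 0 & component_on T p S nu c] &
        forall S' nu, S' \in faces T -> S' != S -> unit_normal S' nu ->
          component_on T p S' nu 0].

Definition N0_shape D T S (v : 'cV[R]_d -> 'cV[R]_d) : Prop :=
  N0_space D T v /\ exists p,
    [/\ elementwise N0_form D T v p,
        exists tau c, [/\ unit_tangent S tau, c != 0 & component_on T p S tau c] &
        forall S' tau, S' \in edges T -> S' != S -> unit_tangent S' tau ->
          component_on T p S' tau 0].

Definition shape_family : Type :=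
  forall kappa : fe_kind,
    simplex R d -> 'cV[R]_d -> 'cV[R]_(value_dim d kappa).

Definition shape_function D T (kappa : fe_kind) S :
    ('cV[R]_d -> 'cV[R]_(value_dim d kappa)) -> Prop :=
  match kappa with
  | S1 => S1_shape D T S
  | RT0 => RT0_shape D T S
  | N0 => N0_shape D T S
  end.

Record discretization := Discretization {
  nfactors : nat;
  factor_kind : 'I_nfactors -> fe_kind;
  factor_index : 'I_nfactors -> {fset simplex R d} }.

Implicit Types (W : discretization) (theta : shape_family).

Definition factor_dim W (k : 'I_(nfactors W)) : nat :=
  value_dim d (factor_kind k).

Definition fe_index W : finType := {k : 'I_(nfactors W) & factor_index k}.

Definition index_dim W (r : 'I_#|fe_index W|) : nat :=
  factor_dim (tag (enum_val r)).

Definition shape_functions D T W theta : Prop :=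
  forall (k : 'I_(nfactors W)) (j : factor_index k),
    shape_function D T (val j) (theta (factor_kind k) (val j)).

Definition theta_at W theta (i : fe_index W) :
    'cV[R]_d -> 'cV[R]_(factor_dim (tag i)) :=
  theta (factor_kind (tag i)) (val (tagged i)).

Definition s_index T W (i : fe_index W) : nat := sharing T (val (tagged i)).

Definition s_max T W : nat := \max_(i : fe_index W) s_index T i.

(* The family (s(i)), up to relabelling the index set of each factor. *)
Definition s_profile T W : seq (seq nat) :=
  [seq sort leq [seq sharing T j | j <- enum_fset (factor_index k)]
     | k <- enum 'I_(nfactors W)].

(* Functions whose k-th block is the component v_(k). *)
Definition product_function W : Type :=
  'cV[R]_d -> 'cV[R]_(\sum_(k < nfactors W) factor_dim k).

(* The factors are the spans of their shape functions; homogeneous boundary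
   conditions amount to keeping only the shape functions of an index subset. *)
Definition fe_space D W theta : set (product_function W) :=
  [set v | exists c : fe_index W -> R, forall k : 'I_(nfactors W),
    ae_on D (fun x => submxcol (v x) k =
      \sum_(j : factor_index k)
        c (Tagged (fun k => factor_index k) j) *:
        theta (factor_kind k) (val j) x)].

(* Dimension, functions being identified if they are equal a.e. in D. *)
Definition has_dim D (q : nat) (V : set ('cV[R]_d -> 'cV[R]_q)) (N : nat) :
    Prop :=
  exists b : 'I_N -> 'cV[R]_d -> 'cV[R]_q,
    (forall i, V (b i)) /\
    forall v, V v ->
      exists! c : 'cV[R]_N, ae_equal D v (fun x => \sum_i c i 0 *: b i x).

End FiniteElements.

Definition size_bound (R : realType) (d : nat) (T : {fset simplex R d})
    (W : discretization R d) (dimW : nat) (C : R) (M : nat) : Prop :=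
  M%:R <= C * d%:R ^+ 2 * (\sum_(i : fe_index W) s_index T i)%:R /\
  C * d%:R ^+ 2 * (\sum_(i : fe_index W) s_index T i)%:R <=
    C * d%:R ^+ 2 * (s_max T W)%:R * dimW%:R.

Arguments fe_space {R d} D W theta.
Arguments fe_index {R d} W.
Arguments index_dim {R d} W r.
Arguments factor_dim {R d} W k.

Inductive space_label := V1 | V2 | V3 | V4.

Section Spaces.
Variables (R : realType) (n : nat).
Implicit Types (D : set 'cV[R]_n.+1) (T : {fset simplex R n.+1})
  (Tf : R) (G : set 'cV[R]_n).

(* The product I x G, where the first coordinate is the time. *)
Definition cylinder (I : set R) G : set 'cV[R]_n.+1 :=
  [set x : 'cV[R]_(1 + n) | I (x 0 0) /\ G (dsubmx x)].

(* The final time Tf and the spatial domain G only matter for V4. *)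
Definition admissible D (l : space_label) Tf G : Prop :=
  match l with
  | V1 | V2 => True
  | V3 => (n.+1 <= 3)%N
  | V4 => [/\ 0 < Tf, polytopal_domain G & D = cylinder `]0, Tf[ G]
  end.

Definition V_space D T (l : space_label) Tf G : discretization R n.+1 :=
  match l with
  | V1 => @Discretization R n.+1 2
      (fun k => if (k == 0 :> nat) then S1 else RT0)
      (fun k => if (k == 0 :> nat) then meeting D (vertices T) else faces T)
  | V2 => @Discretization R n.+1 (2 * n.+1)
      (fun k => if (k < n.+1)%N then S1 else RT0)
      (fun k => if (k < n.+1)%N then meeting D (vertices T) else faces T)
  | V3 => @Discretization R n.+1 2
      (fun k => N0)
      (fun k => if (k == 0 :> nat) then meeting D (edges T) else edges T)
  | V4 => @Discretization R n.+1 n.+1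
      (fun k => S1)
      (fun k => if (k == 0 :> nat) then meeting (cylinder `[0, Tf] G) (vertices T)
                else vertices T)
  end.

End Spaces.

(* [op x c y] plays the role of x + c y: the set NN carries a vector space
   structure with this linear operation. *)
Definition vector_space_with (R : realType) (X : Type) (NN : set X)
    (op : X -> R -> X -> X) : Prop :=
  exists (V : lmodType R) (iota : V -> X),
    [/\ injective iota, range iota = NN &
        forall (x y : V) (c : R), iota (x + c *: y) = op (iota x) c (iota y)].

(* [f] maps NN linearly and bijectively onto the space V of functions, up to
   equality a.e. in D. *)
Definition linear_iso_with (R : realType) (d q : nat) (X : Type)
    (D : set 'cV[R]_d) (NN : set X) (op : X -> R -> X -> X)
    (V : set ('cV[R]_d -> 'cV[R]_q)) (f : X -> 'cV[R]_d -> 'cV[R]_q) : Prop :=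
  [/\ forall x, NN x -> V (f x),
      forall x y c, NN x -> NN y ->
        ae_equal D (f (op x c y)) (fun z => f x z + c *: f y z),
      forall x y, NN x -> NN y -> ae_equal D (f x) (f y) -> x = y &
      forall v, V v -> exists2 x, NN x & ae_equal D (f x) v].

(* Main.v *)
(* Every shape function equals, almost everywhere, the sum over the elements K
   sharing its subsimplex of the indicator of the interior of K times an affine
   map: on any other element the affine representation vanishes at all vertices
   (its face normal, respectively edge tangential, components do), hence is zero.
   Whether x lies in the interior of K is decided by applying BiSU to the
   barycentric coordinates of x and then BiSU to their sum minus d + 1/2.  For
   y in [-C, C] and an indicator h, the product h y is
   relu (y - C (1 - h)) - relu (- y - C (1 - h)), and y itself is transported
   through a ReLU layer as relu (y + C) = y + C.  This takes O(d^2) weights for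
   each pair (i, K), and the degrees of freedom enter through the output layer
   only, so that the network depends linearly on them.  The degrees of freedom
   are unique because an affine map vanishing a.e. on an element vanishes
   identically, which is then tested against the dual functional on a
   subsimplex. *)
Require Import Defs.
From HB Require Import structures.
From mathcomp Require Import all_boot all_order all_algebra finmap.
From mathcomp Require Import all_classical all_reals all_analysis.
From mathcomp Require Import ring lra zify.

Set Implicit Arguments.
Unset Strict Implicit.
Unset Printing Implicit Defensive.

Import Order.TTheory GRing.Theory Num.Theory.
Import numFieldNormedType.Exports.

Local Open Scope classical_set_scope.
Local Open Scope ring_scope.

(** * Lebesgue measure *)

(** The tasks, one for each pair of an index and an element sharing its subsimplex, run side by side
    through identical blocks of neurons. Their number is the sum of the s(i). Geometry, coefficients
    and bounds enter the weights only, so for given d the architecture is a function of that number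
    and of the output dimension. The products are complete after three hidden layers; the fourth
    copies nonnegative values and brings the depth to five. Arguing almost everywhere avoids
    conflicts on the interfaces: outside finitely many hyperplanes exactly one element is active.
    One obstacle is that [lebesgue] is a bare set function defined by recursion, so that unions of
    null sets and the positive measure of balls have to be derived from a comparison with a product
    measure. The vector space of networks is the space of coefficient vectors, transported along a
    map whose injectivity is the linear independence of the shape functions almost everywhere. *)

Definition glue (R : realType) (n : nat)
    (z : measurableTypeR R * borel_space R n) : borel_space R n.+1 :=
  col_mx (z.1%:M : 'M[R]_1) z.2.

Lemma col_mx_scalar00 (R : realType) (n : nat) (t : R) (y : 'cV[R]_n) :
  (col_mx (t%:M : 'M[R]_1) y : 'cV[R]_n.+1) 0 0 = t.
Proof.
rewrite (_ : 0 = lshift n (0 : 'I_1) :> 'I_(1 + n)); last exact: val_inj.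
by rewrite (col_mxEu (t%:M : 'M[R]_1)) mxE.
Qed.

(** Balls are those of the maximum norm, hence boxes, and a box splits off its first coordinate. *)
Lemma ball_col_mx (R : realType) (n : nat) (x : 'cV[R]_n.+1) (e t : R)
    (y : 'cV[R]_n) :
  ball x e (col_mx (t%:M : 'M[R]_1) y) <->
  ball (x 0 0) e t /\ ball (dsubmx (x : 'cV[R]_(1 + n))) e y.
Proof.
have E0 : col_mx (t%:M : 'M[R]_1) y (lshift n (0 : 'I_1)) 0 = t.
  by rewrite col_mxEu mxE.
have l0 : lshift n (0 : 'I_1) = 0 :> 'I_(1 + n) by apply: val_inj.
split=> [[e0 xy]|[xt [e0 xy]]].
  split; first by have := xy (lshift n (0 : 'I_1) : 'I_(1 + n)) 0; rewrite E0 l0.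
  split=> // i j; have := xy (rshift 1 i) j.
  rewrite !mxE; case: split_ordP => // k /eqP; rewrite ?eq_rlshift //.
  by rewrite eq_rshift => /eqP->.
split=> // i j; rewrite ord1; case: (split_ordP (i : 'I_(1 + n))) => k ->.
  by rewrite ord1 E0 l0.
by rewrite (col_mxEd (t%:M : 'M[R]_1)); have := xy k 0; rewrite mxE.
Qed.

Lemma rat_near (R : realType) (n : nat) (x : 'cV[R]_n) (e : R) : 0 < e ->
  exists q : 'cV[rat]_n, ball (map_mx ratr q : 'cV[R]_n) e x.
Proof.
move=> e0.
have near (r : R) : exists q : rat, ball (ratr q : R) e r.
  have /rat_in_itvoo[q] : r - e < r + e by rewrite ltrD2l gt0_cp.
  rewrite in_itv /= => /andP[q1 q2]; exists q.
  by rewrite /ball /= ltr_norml; apply/andP; split; lra.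
have [f fP] := choice near.
by exists (\col_i f (x i 0)); split=> // i j; rewrite !mxE ord1.
Qed.

(** The sigma-algebra on the product is generated by measurable rectangles, so the preimage of an
    open set has to be written as a countable union of them: boxes with rational centres and radii
    1/(k+1) do. *)
Lemma measurable_glue (R : realType) (n : nat) :
  measurable_fun setT (@glue R n).
Proof.
apply (@measurability _ _ (measurableTypeR R * borel_space R n)%type
  (borel_space R n.+1) setT (@glue R n) (@open 'cV[R]_n.+1)) => //.
move=> _ [U oU <-]; rewrite setTI.
pose box (q : rat * 'cV[rat]_n * nat) : set (measurableTypeR R * borel_space R n) :=
  ball (ratr q.1.1 : R) q.2.+1%:R^-1 `*`
  ball (map_mx ratr q.1.2 : 'cV[R]_n) q.2.+1%:R^-1.
(* Boxes that do not fit are replaced by the empty set, so that the union runs over a whole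
   countable type. *)
pose G q := if `[< box q `<=` @glue R n @^-1` U >] then box q else set0.
rewrite (_ : _ @^-1` _ = \bigcup_q G q); last first.
  apply/seteqP; split=> [[t y] /= Uty|z [q _]]; last first.
    by rewrite /G; case: asboolP => // /(_ z).
  have /nbhs_ballP[e /= e0 eU] := open_nbhs_nbhs (conj oU Uty).
  have e20 : 0 < e / 2 by rewrite divr_gt0.
  have [k _ /(_ k (leqnn k)) /= ke] := near_infty_natSinv_lt (PosNum e20).
  have k0 : 0 < k.+1%:R^-1 :> R by rewrite invr_gt0.
  have [q1 q1P] := rat_near (t%:M : 'cV[R]_1) k0.
  have [q2 q2P] := rat_near y k0.
  have yt : box (q1 0 0, q2, k) (t, y).
    by split=> //=; case: q1P => _ /(_ 0 0); rewrite !mxE.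
  exists (q1 0 0, q2, k) => //; rewrite /G; case: asboolP => //; case.
  case: yt => [/= yt1 yt2] [t' y'] [/= yt1' yt2']; apply: eU.
  have ee : k.+1%:R^-1 + k.+1%:R^-1 <= e.
    by rewrite (splitr e) lerD // ltW.
  apply/ball_col_mx; split.
    apply: (le_ball ee); rewrite -(_ : t = glue (t, y) 0 0).
      exact: ball_triangle (ball_sym yt1) yt1'.
    by rewrite [RHS]col_mx_scalar00.
  apply: (le_ball ee); rewrite /glue col_mxKd.
  exact: ball_triangle (ball_sym yt2) yt2'.
apply: countable_bigcupT_measurable => [|q]; first exact: countableP.
rewrite /G; case: ifP => // _; apply: measurableX.
  by rewrite ball_itv; exact: measurable_itv.
by apply: sub_sigma_algebra; exact: ball_open.
Qed.

Lemma measure_sigma_finite_measure (d : measure_display)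
    (T : measurableType d) (R : realType) (m : {measure set T -> \bar R}) :
  sigma_finite setT m ->
  exists mu : {sigma_finite_measure set T -> \bar R},
    (mu : set T -> \bar R) = m.
Proof.
move=> m_fin.
pose sf := isSFinite.Build _ _ _ _ (sfinite_measure_sigma_finite m_fin).
pose sigf := isSigmaFinite.Build _ _ _ _ m_fin.
by exists (HB.pack_for (SigmaFiniteMeasure.type T R) (Measure.sort m) sf sigf).
Qed.

(** Both sides unfold to the same integral of measures of sections, so they agree on every set,
    measurable or not. *)
Lemma lebesgueS (R : realType) (n : nat)
    (mu : {sigma_finite_measure set (borel_space R n) -> \bar R}) :
  (mu : set _ -> \bar R) = @lebesgue R n ->
  @lebesgue R n.+1 =
    pushforward (@lebesgue_measure R \x mu)%E (@glue R n).
Proof.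
move=> mu_eq; apply/funext => A.
rewrite /pushforward /product_measure1 /= -mu_eq; apply: eq_integral => t _ /=.
congr (mu _); apply/seteqP; split=> y /=; rewrite /xsection /= ?inE //.
Qed.

(** The volume of balls is carried through the induction because it yields sigma-finiteness, which
    the next product requires. It also shows later that nonempty open sets are not null. *)
Lemma lebesgue_sigma_finite_measure (R : realType) (n : nat) :
  exists mu : {sigma_finite_measure set (borel_space R n) -> \bar R},
    (mu : set _ -> \bar R) = @lebesgue R n /\
    forall (x : 'cV[R]_n) (e : R), 0 < e -> mu (ball x e) = ((e *+ 2) ^+ n)%:E.
Proof.
elim: n => [|n [mu [mu_eq mu_ball]]].
  exists (dirac (0 : borel_space R 0)); split; first by apply/funext.
  move=> x e e0; rewrite expr0 /= diracE mem_set // /ball /=.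
  by split=> // -[].
pose nu := pushforward (@lebesgue_measure R \x mu)%E (@glue R n).
have nu_ball (x : 'cV[R]_n.+1) (e : R) : 0 < e ->
    nu (ball x e) = ((e *+ 2) ^+ n.+1)%:E.
  move=> e0; rewrite /nu /pushforward.
  rewrite (_ : _ @^-1` _ =
    ball (x 0 0) e `*` ball (dsubmx (x : 'cV[R]_(1 + n))) e); last first.
    by apply/seteqP; split=> -[t y] /=; rewrite /glue => /ball_col_mx.
  rewrite product_measure1E; last 2 first.
  - by rewrite ball_itv; exact: measurable_itv.
  - by apply: sub_sigma_algebra; exact: ball_open.
  rewrite mu_ball // exprS EFinM; congr (_ * _)%E.
  exact: (lebesgue_measure_ball _ (ltW e0)).
have nu_fin : sigma_finite setT nu.
  exists (fun k => ball (0 : 'cV[R]_n.+1) k.+1%:R).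
    apply/seteqP; split=> // x _.
    exists (Num.truncn `|x|) => //=; rewrite -ball_normE /= sub0r normrN.
    exact: truncnS_gt.
  move=> k; split; first by apply: sub_sigma_algebra; exact: ball_open.
  by rewrite nu_ball // ltry.
have [M M_eq] := @measure_sigma_finite_measure _ _ R
  (measure_function_pushforward__canonical__measure_function_Measure
    (@lebesgue_measure R \x mu)%E (@measurable_glue R n)) nu_fin.
exists M; rewrite M_eq; split; last exact: nu_ball.
by rewrite (lebesgueS mu_eq).
Qed.

Lemma continuous_mulmx_entry (R : realType) (m n p : nat) (A : 'M[R]_(m, n))
    (i : 'I_m) (j : 'I_p) : continuous (fun x : 'M[R]_(n, p) => (A *m x) i j).
Proof.
move=> x; rewrite /continuous_at mxE.
under eq_fun do rewrite mxE.
have FF : Filter (nbhs x) by exact: nbhs_filter.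
apply: (@cvg_big _ _ _ _ _ _ _ _ _ _ _ FF) => [|k _].
  exact: add_continuous.
by apply: (cvgMl_tmp (FF := FF)); exact: coord_continuous.
Qed.

Lemma continuous_affine_entry (R : realType) (m n p : nat) (A : 'M[R]_(m, n))
    (i : 'I_m) (j : 'I_p) (b : R) :
  continuous (fun x : 'M[R]_(n, p) => (A *m x) i j + b).
Proof.
move=> x; apply: (@cvgD _ _ _ _ (nbhs_filter x)); last exact: cvg_cst.
exact: continuous_mulmx_entry.
Qed.

(** Induction by sections. If the last coefficients [a2] do not all vanish, every section is a
    hyperplane and null; otherwise only one value of the first coordinate has a nonempty section. *)
Lemma lebesgue_hyperplane (R : realType) (n : nat) (a : 'rV[R]_n) (b : R) :
  a != 0 -> lebesgue [set x | (a *m x) 0 0 + b = 0] = 0%E.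
Proof.
elim: n a b => [a b|n IH a b a_neq0]; first by rewrite thinmx0 eqxx.
rewrite /=; pose a1 := lsubmx (a : 'M[R]_(1, 1 + n)).
pose a2 := rsubmx (a : 'M[R]_(1, 1 + n)).
have section t : [set y : 'cV[R]_n |
      (a *m (col_mx (t%:M : 'M[R]_1) y : 'cV[R]_n.+1)) 0 0 + b = 0] =
    [set y | (a2 *m y) 0 0 + (a1 0 0 * t + b) = 0].
  apply/funext => y /=; congr (_ = _).
  have -> : a *m (col_mx (t%:M : 'M[R]_1) y : 'cV[R]_n.+1) = t *: a1 + a2 *m y.
    by rewrite -mul_mx_scalar -(@mul_row_col R 1 1 n 1) hsubmxK.
  by rewrite !mxE; ring.
under eq_integral do rewrite section.
have [a20|a2_neq0] := eqVneq a2 0; last first.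
  by under eq_integral do rewrite IH //; exact: integral0.
have a1_neq0 : a1 0 0 != 0.
  apply: contra a_neq0 => /eqP a10; apply/eqP.
  rewrite -[a](hsubmxK (a : 'M[R]_(1, 1 + n))) -/a1 -/a2 a20 [a1]mx11_scalar a10.
  by rewrite raddf0 row_mx0.
(* The right-hand side 0 becomes an integral over the single point where the section is nonempty. *)
rewrite -(@integral_set1 R
  (fun t => lebesgue [set y | (a2 *m y) 0 0 + (a1 0 0 * t + b) = 0])
  (- b / a1 0 0)).
rewrite [RHS]integral_mkcond; apply: eq_integral => t _.
rewrite patchE; case: ifPn => // t_neq.
rewrite (_ : [set y | _] = set0).
  by have [mu [<- _]] := lebesgue_sigma_finite_measure R n; rewrite measure0.
apply/seteqP; split=> // y /=; rewrite a20 mul0mx mxE add0r => /eqP.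
rewrite addr_eq0 => /eqP t_eq; move: t_neq; rewrite notin_setE /=; apply.
by rewrite -t_eq mulrAC mulfV // mul1r.
Qed.

(** For a bare set function [almost_everywhere] need not be a filter; here it is one because the
    function coincides with a measure. *)
Lemma ae_lebesgue_filter (R : realType) (n : nat) :
  Filter (almost_everywhere (@lebesgue R n : set (borel_space R n) -> \bar R)).
Proof.
have [mu [<- _]] := lebesgue_sigma_finite_measure R n.
exact: (ae_filter_ringOfSetsType mu).
Qed.

Section AlmostEverywhere.
Variables (R : realType) (n : nat) (D : set 'cV[R]_n).
Implicit Types P Q : 'cV[R]_n -> Prop.

Lemma ae_on_true P : (forall x, D x -> P x) -> ae_on D P.
Proof. by move=> DP; apply: (@filterE _ _ (ae_lebesgue_filter R n)). Qed.

Lemma ae_onS2 P1 P2 Q : (forall x, D x -> P1 x -> P2 x -> Q x) ->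
  ae_on D P1 -> ae_on D P2 -> ae_on D Q.
Proof.
move=> PQ; apply: (@filterS2 _ _ (ae_lebesgue_filter R n)) => x P1x P2x Dx.
by apply: PQ => //; [exact: P1x|exact: P2x].
Qed.

Lemma ae_onS P Q : (forall x, D x -> P x -> Q x) -> ae_on D P -> ae_on D Q.
Proof. by move=> PQ DP; apply: (ae_onS2 _ DP DP) => x Dx Px _; exact: PQ. Qed.

Lemma ae_on_seq (I : eqType) (s : seq I) (P : I -> 'cV[R]_n -> Prop) :
  (forall i, i \in s -> ae_on D (P i)) ->
  ae_on D (fun x => forall i, i \in s -> P i x).
Proof.
elim: s => [_|i s IH Ps]; first exact: ae_on_true.
apply: (ae_onS2 _ (Ps i (mem_head i s))
  (IH (fun j js => Ps j (mem_behead (s := i :: s) js)))) => x _ Pi Pj j.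
by rewrite inE => /predU1P[->|/Pj].
Qed.

Lemma ae_on_fin (I : finType) (P : I -> 'cV[R]_n -> Prop) :
  (forall i, ae_on D (P i)) -> ae_on D (fun x => forall i, P i x).
Proof.
move=> DP; apply: ae_onS (ae_on_seq (s := enum I) (fun i _ => DP i)) => x _ Px i.
by apply: Px; rewrite mem_enum.
Qed.

Lemma ae_on_hyperplane (a : 'rV[R]_n) (b : R) :
  a != 0 -> ae_on D (fun x => (a *m x) 0 0 + b != 0).
Proof.
move=> a_neq0; exists [set x | (a *m x) 0 0 + b = 0]; split.
- rewrite -(setCK [set x | _]); apply: measurableC; apply: sub_sigma_algebra.
  rewrite openC.
  have /continuous_closedP/(_ _ (@closed_eq R 0)) :=
    @continuous_affine_entry R 1 n 1 a 0 0 b.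
  exact.
- exact: lebesgue_hyperplane.
- by move=> x /= /not_implyP[_ /negP]; rewrite negbK => /eqP.
Qed.

(** A ball has positive measure and cannot lie in a null set. *)
Lemma ae_on_dense P (U : set 'cV[R]_n) :
  ae_on D P -> open U -> U `<=` D -> U !=set0 -> exists x, U x /\ P x.
Proof.
move=> [N [mN N0 PN]] oU UD [x Ux]; apply: contrapT => noP.
have /nbhs_ballP[e /= e0 eU] := open_nbhs_nbhs (conj oU Ux).
have eN : ball x e `<=` N.
  move=> y xy; apply: PN => /= Py; apply: noP; exists y.
  by split; [exact: eU|exact/Py/UD/eU].
have [mu [mu_eq mu_ball]] := lebesgue_sigma_finite_measure R n.
have : (mu (ball x e) <= mu N)%E.
  apply: le_measure; rewrite ?inE //.
  by apply: sub_sigma_algebra; exact: ball_open.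
rewrite mu_ball // mu_eq N0 lee_fin leNgt => /negP; apply.
by rewrite exprn_gt0 // pmulrn_lgt0.
Qed.

End AlmostEverywhere.

(** * Barycentric coordinates *)

Section Barycentric.
Variables (R : realType) (d : nat).
Implicit Types (K S : simplex R d) (x : 'cV[R]_d).

Definition affine_form (g : 'rV[R]_d) (b : R) x : R := (g *m x) 0 0 + b.

Lemma affine_formE g b x : affine_form g b x = (g *m x + b%:M) 0 0.
Proof. by rewrite mxE [(_%:M) 0 0]mxE. Qed.

(** [g i] and [b i] are the gradient and the constant term of the i-th barycentric coordinate.
    Listing the vertices in the order of [enum_fset K] turns sums over [K] into sums over
    ordinals. *)
Definition barycentric K (v : 'I_d.+1 -> 'cV[R]_d) (g : 'I_d.+1 -> 'rV[R]_d)
    (b : 'I_d.+1 -> R) : Prop :=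
  [/\ enum_fset K = [seq v i | i <- enum 'I_d.+1],
      forall x, \sum_i affine_form (g i) (b i) x = 1,
      forall x, \sum_i affine_form (g i) (b i) x *: v i = x &
      forall i j, affine_form (g i) (b i) (v j) = (i == j)%:R].

(** By affine independence the matrix with rows (1, v_i) is invertible; the columns of its inverse
    hold the constant terms and gradients of the coordinates. *)
Lemma barycentric_exists K : #|` K| = d.+1 -> affinely_independent K ->
  exists v g b, barycentric K v g b.
Proof.
move=> cardK indepK.
pose v (i : 'I_d.+1) := nth 0 (enum_fset K) i.
have enumK : enum_fset K = [seq v i | i <- enum 'I_d.+1].
  rewrite (map_comp (nth 0 (enum_fset K)) val) val_enum_ord -cardK.
  by rewrite map_nth_iota0 ?take_size.
have sumK (V : nmodType) (F : 'cV[R]_d -> V) : \sum_(p <- K) F p = \sum_i F (v i).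
  by rewrite [LHS](congr1 (fun s => \sum_(p <- s) F p) enumK) big_map big_enum.
have v_inj : injective v.
  move=> i j /eqP; rewrite nth_uniq ?fset_uniq ?[size _]cardK //.
  by move=> /eqP/val_inj.
pose M : 'M[R]_(1 + d) := \matrix_(i < 1 + d) row_mx 1%:M (v i)^T.
have uM (u : 'rV[R]_(1 + d)) :
    u *m M = row_mx (\sum_i u 0 i)%:M (\sum_i u 0 i *: v i)^T.
  rewrite mulmx_sum_row
    (eq_bigr (fun i => row_mx (u 0 i)%:M (u 0 i *: v i)^T)); last first.
    by move=> i _; rewrite rowK scale_row_mx linearZ /= scalemx1.
  elim/big_rec3: _ => [|i y1 y2 y3 _ ->]; first by rewrite raddf0 trmx0 row_mx0.
  by rewrite add_row_mx -raddfD -linearD.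
have Munit : M \in unitmx.
  rewrite -row_free_unit -kermx_eq0; apply/rowV0P => u /sub_kermxP.
  rewrite uM => /eqP; rewrite row_mx_eq0 => /andP[/eqP u1 /eqP u2].
  (* Affine independence speaks of functions on points, so a kernel vector is read as such a
     function through the position of a vertex in the enumeration. *)
  pose c p := u 0 (inord (index p (enum_fset K))).
  have cv i : c (v i) = u 0 i.
    rewrite /c index_uniq ?fset_uniq ?[size _]cardK //; congr (u 0 _).
    exact: inord_val.
  have c0 : forall p, p \in K -> c p = 0.
    apply: indepK; rewrite sumK.
      under eq_bigr do rewrite cv.
      by move/matrixP/(_ 0 0): u1; rewrite !mxE.
    under eq_bigr do rewrite cv.
    by rewrite -[LHS]trmxK u2 trmx0.
  apply/rowP => i; rewrite mxE -cv; apply: c0.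
  by rewrite /= /v mem_nth // [size _]cardK.
pose N := invmx M.
pose g (i : 'I_d.+1) : 'rV[R]_d := (dsubmx (col i N))^T.
pose b (i : 'I_d.+1) : R := N 0 i.
have lamE x i : affine_form (g i) (b i) x = (row_mx 1%:M x^T *m N) 0 i.
  rewrite /affine_form /g /b -[N in RHS]vsubmxK mul_row_col mul1mx addrC !mxE.
  congr (_ + _).
    by congr (N _ _); apply: val_inj.
  by apply: eq_bigr => k _; rewrite !mxE mulrC.
have lamM x : row_mx (\sum_i affine_form (g i) (b i) x)%:M
    (\sum_i affine_form (g i) (b i) x *: v i)^T = row_mx 1%:M x^T.
  rewrite -[RHS](mulmxKV Munit) uM.
  by congr (row_mx _%:M _^T); apply: eq_bigr => i _; rewrite lamE.
exists v, g, b; split=> // [x|x|i j].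
- by have /eq_row_mx[/matrixP/(_ 0 0) + _] := lamM x; rewrite !mxE.
- by have /eq_row_mx[_ /trmx_inj] := lamM x.
- rewrite lamE (_ : row_mx _ _ = row j M); last by rewrite rowK.
  by rewrite -row_mul mulmxV // !mxE eq_sym.
Qed.

(** Weights extended by zero outside [S] can be reused for any larger vertex set. *)
Lemma hullP S x :
  hull S x <-> exists2 w : 'cV[R]_d -> R,
    (forall p, 0 <= w p) /\ (forall p, p \notin S -> w p = 0) &
    \sum_(p <- S) w p = 1 /\ x = \sum_(p <- S) w p *: p.
Proof.
split=> [[w [w0 w1 ->]]|[w [w0 _] [w1 ->]]]; last by exists w.
exists (fun p => if p \in S then w p else 0).
  by split=> p; [case: ifP => // /w0|move=> /negbTE ->].
rewrite -w1; split; apply: eq_big_seq => p; by move=> ->.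
Qed.

Lemma hull_mono S K : (S `<=` K)%fset -> hull S `<=` hull K.
Proof.
move=> SK x /hullP[w [w0 wS] [w1 ->]]; apply/hullP.
have sumK (V : nmodType) (F : 'cV[R]_d -> V) : (forall p, p \notin S -> F p = 0) ->
    \sum_(p <- K) F p = \sum_(p <- S) F p.
  by move=> F0; rewrite [RHS](big_fset_incl _ SK) // => p _ /F0.
exists w; first by split=> // p pK; apply: wS; apply: contra pK; apply/fsubsetP.
by split; rewrite sumK // => p /wS ->; rewrite scale0r.
Qed.

Lemma hull_vertex S p : p \in S -> hull S p.
Proof.
move=> pS; exists (fun q => (q == p)%:R); split.
- by move=> q _; rewrite ler0n.
- rewrite (big_fsetD1 p) //= eqxx big1_fset ?addr0 // => q.
  by rewrite !inE => /andP[/negbTE ->].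
- rewrite (big_fsetD1 p) //= eqxx scale1r big1_fset ?addr0 // => q.
  by rewrite !inE => /andP[/negbTE ->]; rewrite scale0r.
Qed.

Section Coordinates.
Variables (K : simplex R d) (v : 'I_d.+1 -> 'cV[R]_d) (g : 'I_d.+1 -> 'rV[R]_d)
  (b : 'I_d.+1 -> R).
Hypothesis Kvgb : barycentric K v g b.
Local Notation lam i := (affine_form (g i) (b i)).

Lemma barycentric_sum (V : nmodType) (F : 'cV[R]_d -> V) :
  \sum_(p <- K) F p = \sum_i F (v i).
Proof.
have [enumK _ _ _] := Kvgb.
by rewrite [LHS](congr1 (fun s => \sum_(p <- s) F p) enumK) big_map big_enum.
Qed.

Lemma barycentric_mem p : (p \in K) <-> exists i, v i = p.
Proof.
have [enumK _ _ _] := Kvgb.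
rewrite (_ : (p \in K) = (p \in enum_fset K)) // enumK.
split=> [/mapP[i _ ->]|[i <-]]; first by exists i.
by apply/mapP; exists i; rewrite ?mem_enum.
Qed.

Lemma barycentric_vertex i : v i \in K.
Proof. by apply/barycentric_mem; exists i. Qed.

Lemma barycentric_inj : injective v.
Proof.
have [_ _ _ lamv] := Kvgb; move=> i j vij; apply/eqP.
have := lamv i j; rewrite -vij lamv eqxx => /eqP.
by rewrite eqr_nat; case: (i == j).
Qed.

Lemma affine_barycentric (q : nat) (A : 'M[R]_(q, d)) (c : 'cV[R]_q) x :
  A *m x + c = \sum_i lam i x *: (A *m v i + c).
Proof.
have [_ lam1 lamx _] := Kvgb.
rewrite -[in LHS](lamx x) mulmx_sumr -[c in LHS]scale1r -(lam1 x) scaler_suml.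
by rewrite -big_split /=; apply: eq_bigr => i _; rewrite -scalemxAr scalerDr.
Qed.

Lemma affine_vanish (q : nat) (A : 'M[R]_(q, d)) (c : 'cV[R]_q) :
  (forall i, A *m v i + c = 0) -> A = 0 /\ c = 0.
Proof.
move=> Av.
have Ax x : A *m x + c = 0.
  by rewrite affine_barycentric big1 // => i _; rewrite Av scaler0.
have c0 : c = 0 by have := Ax 0; rewrite mulmx0 add0r.
split=> //; apply/matrixP => i j; rewrite [RHS]mxE.
have := Ax (delta_mx j 0); rewrite c0 addr0 -colE => /matrixP/(_ i 0).
by rewrite !mxE.
Qed.

(** The weights of a convex combination are recovered by applying the coordinates to it, so they are
    the coordinates. *)
Lemma hull_barycentric x : hull K x <-> forall i, 0 <= lam i x.
Proof.
have [_ lam1 lamx lamv] := Kvgb.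
split=> [[w [w0 w1 xw]] i|lam0].
  have -> : lam i x = w (v i).
    have -> : lam i x = (\sum_j w (v j) *: (g i *m v j + (b i)%:M)) 0 0.
      under eq_bigr do rewrite scalerDr scalemxAr.
      rewrite big_split /= -mulmx_sumr -scaler_suml.
      rewrite -(barycentric_sum (fun p => w p *: p)) -(barycentric_sum w) w1 -xw.
      by rewrite scale1r affine_formE.
    rewrite summxE (bigD1 i) //= big1 => [|j /negbTE ji].
      by rewrite mxE -affine_formE lamv eqxx mulr1 addr0.
    by rewrite mxE -affine_formE lamv eq_sym ji mulr0.
  by apply: w0; exact: barycentric_vertex.
(* A weight has to be a function of the point, not of its index; the sum has a single term because
   [v] is injective. *)
have lam_index i : lam i x = (fun p => \sum_(j | v j == p) lam j x) (v i).
  rewrite (bigD1 i) ?eqxx //= big1 ?addr0 // => j /andP[/eqP/barycentric_inj ->].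
  by rewrite eqxx.
exists (fun p => \sum_(j | v j == p) lam j x); split=> [p _||].
- exact: sumr_ge0.
- by rewrite barycentric_sum -[RHS](lam1 x); apply: eq_bigr => i _; rewrite -lam_index.
- by rewrite barycentric_sum -[LHS](lamx x); apply: eq_bigr => i _; rewrite -lam_index.
Qed.

End Coordinates.
End Barycentric.

Section OpenSimplex.
Variables (R : realType) (n : nat).
Variables (K : simplex R n.+1) (v : 'I_n.+2 -> 'cV[R]_n.+1)
  (g : 'I_n.+2 -> 'rV[R]_n.+1) (b : 'I_n.+2 -> R).
Hypothesis Kvgb : barycentric K v g b.
Local Notation lam i := (affine_form (g i) (b i)).

(** Stands in for the interior of the hull: strict inequalities between affine forms are what a BiSU
    neuron can test. *)
Definition open_simplex : set 'cV[R]_n.+1 := [set x | forall i, 0 < lam i x].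

Lemma open_simplex_open : open open_simplex.
Proof.
rewrite openE => x lx; apply: (@filter_forall _ _ _ _ (nbhs_filter x)) => i.
have /continuousP/(_ _ (@open_gt R 0)) oi :=
  @continuous_affine_entry R 1 n.+1 1 (g i) 0 0 (b i).
exact: (open_nbhs_nbhs (conj oi (lx i))).
Qed.

Lemma open_simplex_sub : open_simplex `<=` hull K.
Proof. by move=> x lx; apply/(hull_barycentric Kvgb) => i; exact/ltW/lx. Qed.

Lemma open_simplex_neq0 : open_simplex !=set0.
Proof.
have [_ _ _ lamv] := Kvgb.
(* The barycentre, all of whose coordinates equal 1/(n+2). *)
exists (n.+2%:R^-1 *: \sum_i v i) => i.
suff -> : lam i (n.+2%:R^-1 *: \sum_i v i) = n.+2%:R^-1.
  by rewrite invr_gt0.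
have n0 : n.+2%:R != 0 :> R by rewrite pnatr_eq0.
have lamS : \sum_j lam i (v j) = 1.
  rewrite (bigD1 i) //= big1 => [|j /negbTE ji]; first by rewrite lamv eqxx addr0.
  by rewrite lamv eq_sym ji.
move: lamS; rewrite /affine_form big_split /= sumr_const card_ord -summxE -mulmx_sumr.
have -> (a : R) w : (g i *m (a *: w)) 0 0 = a * (g i *m w) 0 0.
  by rewrite -scalemxAr mxE.
move=> lamS.
by apply: (mulfI n0); rewrite mulrDr mulrA mulfV // mul1r mulr_natl.
Qed.

Lemma barycentric_grad_neq0 i : g i != 0.
Proof.
have [_ _ _ lamv] := Kvgb; apply/eqP => gi0.
have := lamv i i; have := lamv i (lift i ord0).
rewrite /affine_form gi0 !mul0mx !mxE !add0r => ->.
by rewrite eqxx (negbTE (neq_lift _ _)) => /eqP; rewrite eq_sym oner_eq0.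
Qed.

Lemma barycentric_grad_vertex i j k :
  (g i *m (v j - v k)) 0 0 = (i == j)%:R - (i == k)%:R.
Proof.
have [_ _ _ lamv] := Kvgb.
by rewrite -!lamv /affine_form mulmxBr !mxE; ring.
Qed.

(** Under the hypothesis [w] and 0 have the same barycentric coordinates. *)
Lemma barycentric_grad_inj (w : 'cV[R]_n.+1) :
  (forall i, (g i *m w) 0 0 = 0) -> w = 0.
Proof.
have [_ _ lamx _] := Kvgb; move=> gw.
rewrite -[LHS](lamx w) -[RHS](lamx 0); apply: eq_bigr => i _.
by rewrite /affine_form gw mulmx0 mxE.
Qed.

Lemma barycentric_grad_sum (w : 'cV[R]_n.+1) : \sum_i (g i *m w) 0 0 = 0.
Proof.
have [_ lam1 _ _] := Kvgb.
have := lam1 0; have := lam1 w; rewrite /affine_form !big_split /=.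
rewrite [in X in _ -> X -> _]big1 => [|i _]; last by rewrite mulmx0 mxE.
by rewrite add0r => + bE; rewrite bE => /eqP; rewrite -subr_eq0 addrK => /eqP.
Qed.

End OpenSimplex.

Section Triangulation.
Variables (R : realType) (n : nat) (D : set 'cV[R]_n.+1)
  (T : {fset simplex R n.+1}).
Hypotheses (DT : triangulation D T).
Variables (v : simplex R n.+1 -> 'I_n.+2 -> 'cV[R]_n.+1)
  (g : simplex R n.+1 -> 'I_n.+2 -> 'rV[R]_n.+1)
  (b : simplex R n.+1 -> 'I_n.+2 -> R).
Hypothesis Tvgb : forall K, K \in T -> barycentric K (v K) (g K) (b K).
Local Notation interiorK K := (open_simplex (g K) (b K)).

(** Off the finitely many hyperplanes spanned by faces, a point of a closed element has strictly
    positive coordinates there; disjointness of the interiors makes the element unique. *)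
Lemma ae_on_open_simplex :
  ae_on D (fun x => exists2 K, K \in T & interiorK K x /\
    forall K', K' \in T -> interiorK K' x -> K' = K).
Proof.
have [_ DK Kdisj _] := DT.
have lam_neq0 : ae_on D (fun x => forall K, K \in enum_fset T ->
    forall i, affine_form (g K i) (b K i) x != 0).
  apply: ae_on_seq => K KT; apply: ae_on_fin => i.
  by apply: ae_on_hyperplane; exact: barycentric_grad_neq0 (Tvgb KT) i.
apply: ae_onS lam_neq0 => x Dx lam_neq0.
have : closure D x by exact: subset_closure.
rewrite DK => -[K KT Kx].
have intKx : interiorK K x.
  move=> i; rewrite lt_def lam_neq0 //.
  by have /(hull_barycentric (Tvgb KT))/(_ i) := Kx.
exists K => //; split=> // K' K'T intK'x; apply: contrapT => /eqP KK'.
have := Kdisj _ _ K'T KT KK'; apply/eqP/set0P; exists x.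
have sub_int K0 : K0 \in T -> interiorK K0 `<=` interior (hull K0).
  move=> K0T; rewrite -open_subsetE; first exact: open_simplex_sub (Tvgb K0T).
  exact: open_simplex_open.
by split; [exact: sub_int intK'x|exact: sub_int intKx].
Qed.

Lemma open_simplex_meets K : K \in T -> open D ->
  (interiorK K `&` D) !=set0.
Proof.
move=> KT oD; have [_ DK _ _] := DT.
have [x Kx] := open_simplex_neq0 (Tvgb KT).
have : closure D x.
  by rewrite DK; exists K => //; exact: open_simplex_sub (Tvgb KT) _ Kx.
move=> /(_ (interiorK K)); rewrite setIC; apply.
by apply: open_nbhs_nbhs; split=> //; exact: open_simplex_open.
Qed.

(** The points where an entry is nonzero form an open set, so vanishing almost everywhere becomes
    vanishing on a nonempty open set; difference quotients along the axes then give [A = 0]. *)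
Lemma affine_ae_zero K (q : nat) (A : 'M[R]_(q, n.+1)) (c : 'cV[R]_q) :
  K \in T -> open D -> ae_on D (fun x => interiorK K x -> A *m x + c = 0) ->
  A = 0 /\ c = 0.
Proof.
move=> KT oD A0.
have oU : open (interiorK K `&` D).
  by apply: openI => //; exact: open_simplex_open.
have {}A0 x : (interiorK K `&` D) x -> A *m x + c = 0.
  move=> Ux; apply: contrapT => /eqP Ax.
  have [i Axi] : exists i, (A *m x + c) i 0 != 0.
    apply: contrapT => nAx; apply: (negP Ax); apply/eqP/colP => i.
    by rewrite [RHS]mxE; apply: contrapT => /eqP Axi; apply: nAx; exists i.
  have oN : open [set y : 'cV[R]_n.+1 | (A *m y) i 0 + c i 0 != 0].
    have /continuousP/(_ _ (@open_neq R 0)) :=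
      @continuous_affine_entry R q n.+1 1 A i 0 (c i 0).
    exact.
  have [||y [[[Ky _] Ay] /(_ Ky)/colP/(_ i)]] := ae_on_dense A0 (openI oU oN).
  - by move=> y [[]].
  - by exists x; split=> //=; move: Axi; rewrite mxE.
  - by rewrite !mxE => Ay0; move: Ay; rewrite /= mxE Ay0 eqxx.
have [x0 Ux0] := open_simplex_meets KT oD.
have /nbhs_ballP[e /= e0 eU] := open_nbhs_nbhs (conj oU Ux0).
have AA : A = 0.
  apply/matrixP => i j; rewrite [RHS]mxE.
  have e20 : e / 2 != 0 by rewrite gt_eqF // divr_gt0.
  (* A step of length e/2 along an axis stays in the ball of radius e around [x0]. *)
  have /A0 : (interiorK K `&` D) (x0 + (e / 2) *: delta_mx j 0).
    apply: eU; split=> // k l; rewrite /ball /= !mxE opprD addNKr normrN normrM.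
    rewrite gtr0_norm ?divr_gt0 //; case: (_ && _).
      by rewrite normr1 mulr1; lra.
    by rewrite normr0 mulr0.
  rewrite mulmxDr addrAC A0 // add0r -scalemxAr -colE => /colP/(_ i).
  by rewrite !mxE => /eqP; rewrite mulf_eq0 (negbTE e20) => /eqP.
by split=> //; have := A0 _ Ux0; rewrite AA mul0mx add0r.
Qed.

End Triangulation.

(** * Local representations of the shape functions *)

Section Dot.
Variables (R : realType) (d : nat).
Implicit Types x y z : 'cV[R]_d.

Lemma dotC x y : dot x y = dot y x.
Proof. by apply: eq_bigr => i _; rewrite mulrC. Qed.

Lemma dotDl x y z : dot (x + y) z = dot x z + dot y z.
Proof.
by rewrite /dot -big_split; apply: eq_bigr => i _; rewrite mxE mulrDl.
Qed.

Lemma dotZl (a : R) x y : dot (a *: x) y = a * dot x y.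
Proof. by rewrite /dot mulr_sumr; apply: eq_bigr => i _; rewrite mxE mulrA. Qed.

Lemma dot0l y : dot 0 y = 0.
Proof. by rewrite -(scale0r 0) dotZl mul0r. Qed.

Lemma dot_suml (I : Type) (s : seq I) (P : pred I) (F : I -> 'cV[R]_d) y :
  dot (\sum_(i <- s | P i) F i) y = \sum_(i <- s | P i) dot (F i) y.
Proof.
by elim/big_rec2: _ => [|i y1 y2 _ <-]; rewrite ?dot0l ?dotDl.
Qed.

Lemma dotZr (a : R) x y : dot x (a *: y) = a * dot x y.
Proof. by rewrite dotC dotZl dotC. Qed.

Lemma dot_gt0 x : x != 0 -> 0 < dot x x.
Proof.
move=> x0; rewrite lt_def; apply/andP; split; last first.
  by apply: sumr_ge0 => i _; rewrite -expr2 sqr_ge0.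
apply: contra x0 => /eqP xx; apply/eqP/colP => i; rewrite [RHS]mxE.
have x_ge0 (j : 'I_d) : true -> 0 <= x j 0 * x j 0 by rewrite -expr2 sqr_ge0.
by have /eqP := psumr_eq0P x_ge0 xx (i := i) isT; rewrite mulf_eq0 orbb => /eqP.
Qed.

Lemma dot_normalize x : x != 0 ->
  exists a : R, [/\ a != 0 & dot (a *: x) (a *: x) = 1].
Proof.
move=> /dot_gt0 xx; exists (Num.sqrt (dot x x))^-1; split.
  by rewrite invr_neq0 // gt_eqF // sqrtr_gt0.
rewrite dotZl dotZr mulrA -invfM -expr2 sqr_sqrtr ?ltW // mulVf //.
by rewrite gt_eqF.
Qed.

Lemma dot_trmx (a : 'rV[R]_d) x : dot x a^T = (a *m x) 0 0.
Proof. by rewrite mxE; apply: eq_bigr => i _; rewrite mxE mulrC. Qed.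

End Dot.

Lemma subsimplicesP (R : realType) (d : nat) (T : {fset simplex R d}) (r : nat)
    (S : simplex R d) :
  S \in subsimplices T r <->
  exists2 K, K \in T & (S `<=` K)%fset /\ #|` S| = r.+1.
Proof.
split=> [/bigfcupP[K /andP[KT _]]|[K KT [SK cardS]]].
  by rewrite !inE /= fpowersetE => /andP[SK /eqP cardS]; exists K.
by apply/bigfcupP; exists K; rewrite ?KT // !inE /= fpowersetE SK cardS eqxx.
Qed.

Section Shapes.
Variables (R : realType) (n : nat) (D : set 'cV[R]_n.+1)
  (T : {fset simplex R n.+1}).
Hypotheses (oD : open D) (DT : triangulation D T).
Variables (v : simplex R n.+1 -> 'I_n.+2 -> 'cV[R]_n.+1)
  (g : simplex R n.+1 -> 'I_n.+2 -> 'rV[R]_n.+1)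
  (b : simplex R n.+1 -> 'I_n.+2 -> R).
Hypothesis Tvgb : forall K, K \in T -> barycentric K (v K) (g K) (b K).
Local Notation interiorK K := (open_simplex (g K) (b K)).
Implicit Types (S K : simplex R n.+1).

Definition represents K (q : nat) (f : 'cV[R]_n.+1 -> 'cV[R]_q)
    (Ac : 'M[R]_(q, n.+1) * 'cV[R]_q) : Prop :=
  ae_on D (fun x => interiorK K x -> f x = Ac.1 *m x + Ac.2).

Lemma represents_uniq K (q : nat) (f : 'cV[R]_n.+1 -> 'cV[R]_q) Ac Ac' :
  K \in T -> represents K f Ac -> represents K f Ac' -> Ac = Ac'.
Proof.
case: Ac Ac' => [A c] [A' c'] KT fA fA'.
have [|AA cc] := @affine_ae_zero _ _ _ _ DT _ _ _ Tvgb K q (A - A') (c - c') KT oD.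
  apply: ae_onS2 fA fA' => x _ /= fA fA' Kx.
  by rewrite mulmxBl addrACA -opprD -fA // -fA' // subrr.
by rewrite (subr0_eq AA) (subr0_eq cc).
Qed.

Lemma represents_on_hull K (q : nat) (f p : 'cV[R]_n.+1 -> 'cV[R]_q) A c :
  K \in T -> ae_equal (D `&` hull K) f p -> (forall x, p x = A *m x + c) ->
  represents K f (A, c).
Proof.
move=> KT fp pA; have [N [mN N0 fN]] := fp; exists N; split=> //.
move=> x /= nfx; apply: fN => /= fpx; apply: nfx => Dx Kx.
rewrite -pA; apply: fpx; split=> //.
exact: open_simplex_sub (Tvgb KT) _ Kx.
Qed.

(* Evaluating the representation on [K] at [x] in the direction [nu] is a
   functional dual to [S]. *)
Definition separated (q : nat) (J : {fset simplex R n.+1})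
    (shape : simplex R n.+1 -> ('cV[R]_n.+1 -> 'cV[R]_q) -> Prop) S f : Prop :=
  exists K x nu, [/\ K \in T,
    forall Ac, represents K f Ac -> dot (Ac.1 *m x + Ac.2) nu != 0 &
    forall S' f' Ac, S' \in J -> S' != S -> shape S' f' ->
      represents K f' Ac -> dot (Ac.1 *m x + Ac.2) nu = 0].

(** The zero representation off the elements sharing [S] is the locality that limits the tasks of an
    index i to s(i). *)
Definition local_rep (q : nat) S (f : 'cV[R]_n.+1 -> 'cV[R]_q)
    (Ac : simplex R n.+1 -> 'M[R]_(q, n.+1) * 'cV[R]_q) : Prop :=
  forall K, K \in T -> represents K f (Ac K) /\
    (~ hull S `<=` hull K -> Ac K = (0, 0)).

Lemma S1_local_rep S f : S1_shape D T S f -> exists Ac, local_rep S f Ac.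
Proof.
move=> [[_ fK] fS].
have {fK} fK K : exists Ac : 'M[R]_(1, n.+1) * 'cV[R]_1, K \in T ->
    forall x, hull K x -> f x = Ac.1 *m x + Ac.2.
  have [KT|KT] := boolP (K \in T); last by exists (0, 0).
  by have [a [c fac]] := fK K KT; exists (a, c).
have [Ac fAc] := choice fK.
exists Ac => K KT; split.
  apply: ae_on_true => x _ Kx; apply: fAc => //.
  exact: open_simplex_sub (Tvgb KT) _ Kx.
move=> nSK; have [|A0 c0] := affine_vanish (Tvgb KT) (A := (Ac K).1) (c := (Ac K).2).
  move=> i; have vK := barycentric_vertex (Tvgb KT) i.
  rewrite -fAc //; last exact: hull_vertex.
  apply/colP => j; rewrite (ord1 j) fS ?mxE.
    case: eqP => // Sv; exfalso; apply: nSK; apply: hull_mono; rewrite -Sv.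
    by rewrite fsub1set.
  by apply/subsimplicesP; exists K => //; rewrite fsub1set vK cardfs1.
by rewrite [LHS]surjective_pairing A0 c0.
Qed.

(** The dual functional is evaluation at the vertex itself, read on any element containing it. *)
Lemma S1_separated S f : S \in vertices T -> S1_shape D T S f ->
  separated (vertices T) (S1_shape D T) S f.
Proof.
move=> ST; have /subsimplicesP[K KT [SK /eqP/cardfs1P[p Sp]]] := ST.
move=> Sf; exists K, p, (const_mx 1).
have pK : hull K p by apply: hull_vertex; rewrite -fsub1set -Sp.
have eval S' f' Ac : S1_shape D T S' f' -> represents K f' Ac ->
    dot (Ac.1 *m p + Ac.2) (const_mx 1) = if S == S' then 1 else 0.
  move=> [[_ /(_ K KT)[a [c fac]]] f'S'] f'Ac.
  have -> : Ac = (a, c).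
    apply: (represents_uniq KT f'Ac); apply: ae_on_true => x _ Kx; apply: fac.
    exact: open_simplex_sub (Tvgb KT) _ Kx.
  by rewrite /= -fac // /dot big_ord1 mxE mulr1 f'S' -?Sp.
split=> // [Ac fAc|S' f' Ac _ S'S S'f' f'Ac].
  by rewrite (eval S f) // eqxx oner_eq0.
by rewrite (eval S' f') // eq_sym (negbTE S'S).
Qed.

(** * Vector fields determined by normal or tangential components *)

Section Fields.
Variables (form : ('cV[R]_n.+1 -> 'cV[R]_n.+1) -> Prop)
  (dir : simplex R n.+1 -> 'cV[R]_n.+1 -> Prop) (J : {fset simplex R n.+1}).
Hypothesis form_affine : forall p, form p ->
  exists (A : 'M[R]_n.+1) (c : 'cV[R]_n.+1), forall x, p x = A *m x + c.
Hypothesis J_sub : forall S, S \in J ->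
  exists2 K, K \in T & (S `<=` K)%fset /\ S != fset0.
Hypothesis J_unisolvent : forall K (A : 'M[R]_n.+1) (c : 'cV[R]_n.+1),
  K \in T ->
  (forall S nu x, S \in J -> (S `<=` K)%fset -> dir S nu -> x \in S ->
    dot (A *m x + c) nu = 0) -> A = 0 /\ c = 0.

(** The part common to [RT0_shape] and [N0_shape]: [J] consists of the faces or the edges, and [dir]
    relates them to their unit normals or unit tangents. *)
Definition field_shape S (f : 'cV[R]_n.+1 -> 'cV[R]_n.+1) : Prop :=
  exists p, [/\ elementwise form D T f p,
    exists nu c, [/\ dir S nu, c != 0 & component_on T p S nu c] &
    forall S' nu, S' \in J -> S' != S -> dir S' nu -> component_on T p S' nu 0].

Lemma elementwise_affine f p : elementwise form D T f p ->
  exists Ac : simplex R n.+1 -> 'M[R]_n.+1 * 'cV[R]_n.+1,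
    forall K, K \in T -> represents K f (Ac K) /\
      forall x, p K x = (Ac K).1 *m x + (Ac K).2.
Proof.
move=> fp; have pK K : exists Ac : 'M[R]_n.+1 * 'cV[R]_n.+1, K \in T ->
    represents K f Ac /\ forall x, p K x = Ac.1 *m x + Ac.2.
  have [KT|KT] := boolP (K \in T); last by exists (0, 0).
  have [/form_affine[A [c pAc]] fpK] := fp K KT; exists (A, c) => _.
  by split=> //; exact: represents_on_hull fpK pAc.
by have [Ac fAc] := choice pK; exists Ac.
Qed.

Lemma field_local_rep S f : field_shape S f -> exists Ac, local_rep S f Ac.
Proof.
move=> [p [/elementwise_affine[Ac fAc] _ pJ]]; exists Ac => K KT.
have [fK pK] := fAc K KT; split=> // nSK.
have [|A0 c0] := @J_unisolvent K (Ac K).1 (Ac K).2 KT.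
  move=> S' nu x S'J S'K nuS' xS'; rewrite -pK.
  apply: (pJ S' nu) => //; [|exact: hull_mono|exact: hull_vertex].
  by apply/eqP => S'S; apply: nSK; rewrite -S'S; exact: hull_mono.
by rewrite [LHS]surjective_pairing A0 c0.
Qed.

(** The direction is the one in which [f] is known to have a nonzero component along [S]; the other
    shape functions vanish in every admissible direction of [S], in particular in this one. *)
Lemma field_separated S f : S \in J -> field_shape S f ->
  separated J field_shape S f.
Proof.
move=> SJ; have [K KT [SK /fset0Pn[x xS]]] := J_sub SJ.
move=> [p [/elementwise_affine[Ac /(_ K KT)[fAc pAc]] [nu [c [nuS c0 pc]]] _]].
exists K, x, nu; split=> // [Ac' fAc'|S' f' Ac' S'J S'S].
  rewrite (represents_uniq KT fAc' fAc) -pAc (pc K KT) //; first exact: hull_mono.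
  exact: hull_vertex.
move=> [p' [/elementwise_affine[Bc /(_ K KT)[fBc pBc]] _ p'J]] f'Ac'.
rewrite (represents_uniq KT f'Ac' fBc) -pBc (p'J S nu) //.
- by rewrite eq_sym.
- exact: hull_mono.
- exact: hull_vertex.
Qed.

End Fields.

(** The faces through the vertex v_i are those opposite the other vertices v_j, with normals the
    gradients of the j-th coordinates. The value at v_i is orthogonal to these, and to the i-th
    gradient because the gradients sum to zero; the gradients separate vectors. *)
Lemma RT0_unisolvent K (A : 'M[R]_n.+1) (c : 'cV[R]_n.+1) : K \in T ->
  (forall S nu x, S \in faces T -> (S `<=` K)%fset -> unit_normal S nu ->
    x \in S -> dot (A *m x + c) nu = 0) -> A = 0 /\ c = 0.
Proof.
move=> KT normal0; have bK := Tvgb KT; have [/(_ K KT)[cardK _] _ _ _] := DT.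
apply: (affine_vanish bK) => i; set w := A *m v K i + c.
have gw j : j != i -> (g K j *m w) 0 0 = 0.
  move=> ji; pose S := (K `\ v K j)%fset.
  have gj0 : (g K j)^T != 0 by rewrite trmx_eq0 (barycentric_grad_neq0 bK).
  have [a [a0 unit_a]] := dot_normalize gj0.
  have memS y : y \in S -> exists2 k, k != j & y = v K k.
    rewrite in_fsetD1 => /andP[yj /(barycentric_mem bK)[k yk]].
    by exists k => //; apply: contraNneq yj => <-; rewrite yk.
  have : dot w (a *: (g K j)^T) = 0.
    apply: (normal0 S).
    - apply/subsimplicesP; exists K => //; split; first exact: fsubD1set.
      have := cardfsD1 (v K j) K.
      by rewrite (barycentric_vertex bK) cardK add1n => -[<-].
    - exact: fsubD1set.
    - split=> // x y /memS[k kj ->] /memS[l lj ->].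
      rewrite dotC dotZr dot_trmx (barycentric_grad_vertex bK).
      by rewrite eq_sym (negbTE kj) eq_sym (negbTE lj) subrr mulr0.
    - rewrite in_fsetD1 (barycentric_vertex bK) andbT.
      by apply: contra ji => /eqP/(barycentric_inj bK) ->.
  by rewrite dotZr dot_trmx => /eqP; rewrite mulf_eq0 (negbTE a0) => /eqP.
apply: (barycentric_grad_inj bK) => j.
have [->|] := eqVneq j i; last exact: gw.
have := barycentric_grad_sum bK w.
by rewrite (bigD1 i) //= big1 ?addr0 // => k ki; exact: gw.
Qed.

(** The value [w] at v_i is orthogonal to all edges leaving v_i. *)
Lemma N0_unisolvent K (A : 'M[R]_n.+1) (c : 'cV[R]_n.+1) : K \in T ->
  (forall S tau x, S \in edges T -> (S `<=` K)%fset -> unit_tangent S tau ->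
    x \in S -> dot (A *m x + c) tau = 0) -> A = 0 /\ c = 0.
Proof.
move=> KT tangent0; have bK := Tvgb KT.
apply: (affine_vanish bK) => i; set w := A *m v K i + c.
have vw j : dot (v K j - v K i) w = 0.
  have [->|ji] := eqVneq j i; first by rewrite subrr dot0l.
  have vij : v K j - v K i != 0.
    by rewrite subr_eq0; apply: contra ji => /eqP/(barycentric_inj bK) ->.
  have [a [a0 unit_a]] := dot_normalize vij.
  have SK : ([fset v K j; v K i] `<=` K)%fset.
    by rewrite fsubUset !fsub1set !(barycentric_vertex bK).
  have : dot w (a *: (v K j - v K i)) = 0.
    apply: (tangent0 [fset v K j; v K i]%fset) => //.
    - apply/subsimplicesP; exists K => //; split=> //.
      by rewrite cardfs2 -subr_eq0 vij.
    - by split=> //; exists (v K j), (v K i), a; rewrite !inE !eqxx orbT.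
    - by rewrite !inE eqxx orbT.
  by rewrite dotZr dotC => /eqP; rewrite mulf_eq0 (negbTE a0) => /eqP.
(* Every point is an affine combination of the vertices, so the linear form [dot y w] is constant in
   [y], hence zero, also at [y = w]. *)
have wE y : dot y w = dot (v K i) w.
  have [_ lam1 lamx _] := bK.
  rewrite -[in LHS](lamx y) -[in RHS](scale1r (v K i)) -(lam1 y) scaler_suml.
  rewrite !dot_suml; apply: eq_bigr => j _; rewrite !dotZl; congr (_ * _).
  by rewrite -[v K j](subrK (v K i)) dotDl vw add0r.
apply/eqP; apply: contraT => /dot_gt0.
by rewrite wE -(wE 0) dot0l ltxx.
Qed.

Definition shape_indices (kappa : fe_kind) : {fset simplex R n.+1} :=
  match kappa with S1 => vertices T | RT0 => faces T | N0 => edges T end.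

Lemma subsimplices_sub r S : S \in subsimplices T r ->
  exists2 K, K \in T & (S `<=` K)%fset /\ S != fset0.
Proof.
move=> /subsimplicesP[K KT [SK cardS]]; exists K => //; split=> //.
by rewrite -cardfs_gt0 cardS.
Qed.

Lemma RT0_form_affine p : RT0_form p ->
  exists (A : 'M[R]_n.+1) (c : 'cV[R]_n.+1), forall x, p x = A *m x + c.
Proof.
move=> [a [t pE]]; exists t%:M, a => x.
by rewrite pE mul_scalar_mx addrC.
Qed.

Lemma N0_form_affine p : N0_form p ->
  exists (A : 'M[R]_n.+1) (c : 'cV[R]_n.+1), forall x, p x = A *m x + c.
Proof. by move=> [a [B [_ pE]]]; exists B, a => x; rewrite pE addrC. Qed.

Lemma shape_local_rep kappa S f : shape_function D T S f ->
  exists Ac, @local_rep (value_dim n.+1 kappa) S f Ac.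
Proof.
case: kappa f => f; first exact: S1_local_rep.
- move=> [_]; apply: field_local_rep; [exact: RT0_form_affine|exact: RT0_unisolvent].
- move=> [_]; apply: field_local_rep; [exact: N0_form_affine|exact: N0_unisolvent].
Qed.

Lemma shape_separated kappa S f : S \in shape_indices kappa ->
  shape_function D T S f ->
  separated (shape_indices kappa)
    (@shape_function R n.+1 D T kappa) S f.
Proof.
case: kappa f => f SJ; first exact: S1_separated.
- move=> [_ Sf].
  have [K [x [nu [KT fS fS']]]] := field_separated RT0_form_affine
    (@subsimplices_sub _) SJ Sf.
  by exists K, x, nu; split=> // S' f' Ac S'J S'S [_]; exact: fS'.
- move=> [_ Sf].
  have [K [x [nu [KT fS fS']]]] := field_separated N0_form_affine
    (@subsimplices_sub _) SJ Sf.
  by exists K, x, nu; split=> // S' f' Ac S'J S'S [_]; exact: fS'.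
Qed.

(** The set that [sharing] counts. *)
Definition elements S : {fset simplex R n.+1} :=
  [fset K in T | `[< (hull S `<=` hull K)%classic >]]%fset.

Definition inside K x : bool := [forall i, 0 < affine_form (g K i) (b K i) x].

Lemma insideP K x : reflect (interiorK K x) (inside K x).
Proof. exact: forallP. Qed.

Lemma local_rep_sum (q : nat) S (f : 'cV[R]_n.+1 -> 'cV[R]_q) Ac :
  local_rep S f Ac ->
  ae_on D (fun x => f x = \sum_(K : elements S)
    (inside (val K) x)%:R *: ((Ac (val K)).1 *m x + (Ac (val K)).2)).
Proof.
move=> fAc.
have fK : ae_on D (fun x => forall K, K \in enum_fset T ->
    interiorK K x -> f x = (Ac K).1 *m x + (Ac K).2).
  by apply: ae_on_seq => K KT; have [] := fAc K KT.
apply: ae_onS2 fK (ae_on_open_simplex DT Tvgb) => x _ fK [K KT [Kx K_uniq]].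
rewrite (fK K KT Kx) -(big_seq_fsetE _ _ xpredT (fun K =>
  (inside K x)%:R *: ((Ac K).1 *m x + (Ac K).2))) /=.
have out K' : K' \in elements S -> K' != K ->
    (inside K' x)%:R *: ((Ac K').1 *m x + (Ac K').2) = 0.
  rewrite !inE /= => /andP[K'T _] K'K; case: insideP => [/(K_uniq _ K'T)|_].
    by move/eqP: K'K.
  by rewrite scale0r.
have [KS|KS] := boolP (K \in elements S).
  rewrite (big_fsetD1 K) //= (introT (insideP _ _) Kx) scale1r.
  by rewrite big1_fset ?addr0 // => K'; rewrite in_fsetD1 => /andP[K'K /out ->].
(* The active element does not share [S]: every summand vanishes, and so does [f], whose
   representation there is zero. *)
rewrite big1_fset => [|K' K'S _]; last first.
  by apply: out => //; apply: contraNneq KS => <-.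
have [_ ->] := fAc K KT; first by rewrite mul0mx addr0.
by move=> SK; move: KS; rewrite !inE /= KT; case: asboolP.
Qed.

Lemma shapes_independent kappa (J : {fset simplex R n.+1})
    (f : simplex R n.+1 -> 'cV[R]_n.+1 -> 'cV[R]_(value_dim n.+1 kappa))
    (c : J -> R) :
  (J `<=` shape_indices kappa)%fset ->
  (forall j : J, shape_function D T (val j) (f (val j))) ->
  ae_on D (fun x => \sum_(j : J) c j *: f (val j) x = 0) -> forall j, c j = 0.
Proof.
move=> J_sub fJ f0 j.
have Jj (j' : J) : val j' \in shape_indices kappa.
  by apply: (fsubsetP J_sub); exact: fsvalP.
have [K [x [nu [KT fj fj']]]] := shape_separated (Jj j) (fJ j).
have [Ac AcP] := choice (fun j' => shape_local_rep (fJ j')).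
have repK j' : represents K (f (val j')) (Ac j' K) by have [] := AcP j' K KT.
(* On [K] the zero function is represented by the combination and by (0, 0); uniqueness equates
   them. *)
have rep0 : represents K (fun=> 0)
    (\sum_(j' : J) c j' *: (Ac j' K).1, \sum_(j' : J) c j' *: (Ac j' K).2).
  have fK := ae_on_fin repK.
  apply: ae_onS2 f0 fK => y _ f0y fK Ky /=.
  rewrite -[LHS]f0y mulmx_suml -big_split /=; apply: eq_bigr => j' _.
  by rewrite fK // -scalemxAl scalerDr.
have := represents_uniq KT rep0 (Ac' := (0, 0)).
have rep00 : represents K (fun=> 0) ((0 : 'M[R]_(value_dim n.+1 kappa, n.+1)), 0).
  by apply: ae_on_true => y _ _; rewrite /= mul0mx addr0.
move=> /(_ rep00)[A0 c0].
have : dot ((\sum_(j' : J) c j' *: (Ac j' K).1) *m x +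
    \sum_(j' : J) c j' *: (Ac j' K).2) nu = 0 by rewrite A0 c0 mul0mx addr0 dot0l.
rewrite mulmx_suml -big_split dot_suml (bigD1 j) //= big1 ?addr0 => [|j' j'j].
  rewrite -scalemxAl -scalerDr dotZl => /eqP; rewrite mulf_eq0.
  by rewrite (negbTE (fj _ (repK j))) orbF => /eqP.
rewrite -scalemxAl -scalerDr dotZl (fj' (val j') (f (val j'))) ?mulr0 //.
Qed.

End Shapes.

(** * Networks *)

Section NonzeroCount.
Variable R : realType.

Lemma nnzE (m n : nat) (A : 'M[R]_(m, n)) :
  nnz A = (\sum_i \sum_j (A i j != 0)%R)%N.
Proof.
rewrite /nnz -sum1_card pair_big /= big_mkcond /=.
by apply: eq_bigr => -[i j] _; rewrite inE; case: (_ != _).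
Qed.

(** [s i] lists the columns in which row [i] may be nonzero, so a sparsity pattern bounds the
    count. *)
Lemma nnz_rows (m n : nat) (A : 'M[R]_(m, n)) (s : 'I_m -> seq 'I_n) :
  (forall i j, A i j != 0 -> j \in s i) -> (nnz A <= \sum_i size (s i))%N.
Proof.
move=> As; rewrite nnzE leq_sum // => i _.
apply: leq_trans (card_size (s i)).
rewrite -sum1_card [leqRHS]big_mkcond leq_sum //= => j _.
by case: ifP => [_|]; [exact: leq_b1|case: (A i j != 0) (As i j) => // ->].
Qed.

Lemma nnz_cols (m n : nat) (A : 'M[R]_(m, n)) (s : 'I_n -> seq 'I_m) :
  (forall i j, A i j != 0 -> i \in s j) -> (nnz A <= \sum_j size (s j))%N.
Proof.
move=> As; apply: leq_trans (nnz_rows (A := A^T) (s := s) _); last first.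
  by move=> j i; rewrite mxE => /As.
rewrite !nnzE exchange_big /= leq_sum // => i _; rewrite leq_sum // => j _.
by rewrite mxE.
Qed.

Lemma nnz_max (m n : nat) (A : 'M[R]_(m, n)) : (nnz A <= m * n)%N.
Proof. by rewrite /nnz (leq_trans (max_card _)) // card_prod !card_ord. Qed.

Lemma nnz0 (m n : nat) : nnz (0 : 'M[R]_(m, n)) = 0%N.
Proof.
by rewrite nnzE big1 // => i _; rewrite big1 // => j _; rewrite mxE eqxx.
Qed.

End NonzeroCount.

Section IndexedLayers.
Variable R : realType.
Implicit Types I J : finType.

(** Neurons are labelled by finite types (task, coordinate, sign); going through the enumeration
    turns matrix products into sums over labels. *)
Definition indexed_mx I J (w : I -> J -> R) : 'M[R]_(#|I|, #|J|) :=
  \matrix_(i, j) w (enum_val i) (enum_val j).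

Definition indexed_col J (y : J -> R) : 'cV[R]_#|J| := \col_j y (enum_val j).

Definition indexed_tuple J (rho : J -> R -> R) : #|J|.-tuple (R -> R) :=
  [tuple rho (enum_val j) | j < #|J|].

Lemma sum_indexed J (F : J -> R) : \sum_(j < #|J|) F (enum_val j) = \sum_j F j.
Proof. by rewrite -(@big_enum_val _ _ _ J J). Qed.

Lemma indexed_mulmx I J (w : I -> J -> R) (y b : _ -> R) :
  indexed_mx w *m indexed_col y + indexed_col b =
  indexed_col (fun i => \sum_j w i j * y j + b i).
Proof.
apply/colP => i; rewrite !mxE; congr (_ + _); rewrite -[RHS]sum_indexed.
by apply: eq_bigr => j _; rewrite !mxE.
Qed.

Lemma indexed_hidden (q : nat) I J (w : I -> J -> R) (y b : _ -> R)
    (rho : I -> R -> R) (Psi : network R q #|I|) :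
  realization (HiddenLayer (indexed_mx w) (indexed_col b) (indexed_tuple rho) Psi)
    (indexed_col y) =
  realization Psi (indexed_col (fun i => rho i (\sum_j w i j * y j + b i))).
Proof.
rewrite /=; congr (realization _ _); apply/colP => i.
by rewrite mxE tnth_mktuple indexed_mulmx !mxE.
Qed.

Lemma nnz_indexed_mx I J (w : I -> J -> R) (s : I -> seq J) :
  (forall i j, w i j != 0 -> j \in s i) ->
  (nnz (indexed_mx w) <= \sum_i size (s i))%N.
Proof.
move=> ws; apply: leq_trans (nnz_rows
  (s := fun i => [seq enum_rank j | j <- s (enum_val i)]) _) _.
  move=> i j; rewrite mxE => /ws ij.
  by apply/mapP; exists (enum_val j); rewrite ?enum_valK.
rewrite -(@big_enum_val _ _ _ I I (fun i => size [seq enum_rank j | j <- s i])).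
by under eq_bigr do rewrite size_map.
Qed.

Lemma nnz_indexed_col J (y : J -> R) : (nnz (indexed_col y) <= #|J|)%N.
Proof. by rewrite (leq_trans (nnz_max _)) ?muln1. Qed.

End IndexedLayers.

Lemma big_option (V : nmodType) (J : finType) (F : option J -> V) :
  \sum_o F o = F None + \sum_j F (Some j).
Proof.
rewrite (bigD1 None) //= (reindex_omap Some id) => [|[j|]] //=.
by congr (_ + _); apply: eq_bigl => j; rewrite eqxx.
Qed.

(** * The network for a finite family of tasks *)

Section TaskNetwork.
Variables (R : realType) (d P q : nat).

(** Each task owns d+1 BiSU neurons for the coordinates and d ReLU neurons for the shifted values;
    then one indicator [None] and the d values; then, for each value, its positive and negative
    parts, [true] marking the negative one. *)
Definition layer1 : finType := ('I_P * ('I_d.+1 + 'I_d))%type.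
Definition layer2 : finType := ('I_P * option 'I_d)%type.
Definition layer3 : finType := ('I_P * 'I_d * bool)%type.

Definition activation1 (u : layer1) : R -> R :=
  if u.2 is inl _ then @bisu R else @relu R.
Definition activation2 (u : layer2) : R -> R :=
  if u.2 is None then @bisu R else @relu R.
Definition activation3 (u : layer3) : R -> R := @relu R.

(** It is built from [d], [P] and [q] before any weight is introduced. The second copy of [layer3]
    is the one that only passes values on. *)
Definition task_arch : architecture R :=
  ([:: #|layer1|; #|layer2|; #|layer3|; #|layer3|; q],
   [:: indexed_tuple activation1 : seq _; indexed_tuple activation2 : seq _;
       indexed_tuple activation3 : seq _; indexed_tuple activation3 : seq _;
       nseq q id]).

Variables (g : 'I_P -> 'I_d.+1 -> 'rV[R]_d) (b : 'I_P -> 'I_d.+1 -> R)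
  (A : 'I_P -> 'M[R]_d) (c : 'I_P -> 'cV[R]_d) (C : R)
  (O : 'I_q -> 'I_P -> 'I_d -> R).

Definition weight1 (u : layer1) (k : 'I_d) : R :=
  match u.2 with inl i => g u.1 i 0 k | inr j => A u.1 j k end.
Definition bias1 (u : layer1) : R :=
  match u.2 with inl i => b u.1 i | inr j => c u.1 j 0 + C end.

Definition block2 (o : option 'I_d) (s : 'I_d.+1 + 'I_d) : R :=
  match o, s with
  | None, inl _ => 1
  | Some j, inr j' => (j' == j)%:R
  | _, _ => 0
  end.
Definition weight2 (u : layer2) (u' : layer1) : R :=
  if u'.1 == u.1 then block2 u.2 u'.2 else 0.
Definition bias2 (u : layer2) : R := if u.2 is None then - d%:R - 2^-1 else 0.

Definition block3 (j : 'I_d) (s : bool) (o : option 'I_d) : R :=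
  if o is Some j' then (if j' == j then (-1) ^+ s else 0) else C.
Definition weight3 (u : layer3) (u' : layer2) : R :=
  if u'.1 == u.1.1 then block3 u.1.2 u.2 u'.2 else 0.
(** The term with the sign undoes the shift by [C] of the incoming value; with weight [C] on the
    indicator h, the neuron receives y - C (1 - h) or - y - C (1 - h). *)
Definition bias3 (u : layer3) : R := - C - (-1) ^+ u.2 * C.

Definition weight4 (u u' : layer3) : R := (u' == u)%:R.

Definition output_weight (r : 'I_q) (u : layer3) : R :=
  (-1) ^+ u.2 * O r u.1.1 u.1.2.

Definition task_network : network R q d :=
  HiddenLayer (\matrix_(u < #|layer1|, k < d) weight1 (enum_val u) k)
    (indexed_col bias1) (indexed_tuple activation1)
  (HiddenLayer (indexed_mx weight2) (indexed_col bias2)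
    (indexed_tuple activation2)
  (HiddenLayer (indexed_mx weight3) (indexed_col bias3)
    (indexed_tuple activation3)
  (HiddenLayer (indexed_mx weight4) (indexed_col (fun=> 0))
    (indexed_tuple activation3)
  (OutputLayer (\matrix_(r < q, u < #|layer3|) output_weight r (enum_val u))
    0)))).

Lemma arch_task_network : arch task_network = task_arch.
Proof. by []. Qed.

Lemma relu_bisu_task_network :
  (0 < P)%N -> (0 < d)%N -> (0 < q)%N -> relu_bisu_network task_network.
Proof.
move=> P0 d0 q0; split.
  rewrite /= q0 !andbT !card_prod !card_sum card_option card_bool !card_ord.
  by rewrite !muln_gt0 P0 d0 !addn_gt0 d0 orbT.
split=> [i|]; last split=> [i|]; last split=> [i|]; last split=> [i|//].
- by rewrite tnth_mktuple /activation1; case: (enum_val i).2; [right|left].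
- by rewrite tnth_mktuple /activation2; case: (enum_val i).2; [left|right].
- by rewrite tnth_mktuple; left.
- by rewrite tnth_mktuple; left.
Qed.

(** The second and third weight matrices are block diagonal over the tasks. *)
Lemma sum_block (I J : finType) (i : I) (h : J -> R) (y : I * J -> R) :
  \sum_p (if p.1 == i then h p.2 else 0) * y p = \sum_j h j * y (i, j).
Proof.
rewrite (eq_bigr (fun p => (if p.1 == i then h p.2 else 0) * y (p.1, p.2)));
  last by case.
rewrite -(pair_bigA _ (fun i' j => (if i' == i then h j else 0) * y (i', j))) /=.
rewrite (bigD1 i) //= eqxx [X in _ + X]big1 ?addr0 // => i' /negbTE ->.
by rewrite big1 // => j _; rewrite mul0r.
Qed.

Definition task_inside (t : 'I_P) (x : 'cV[R]_d) : bool :=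
  [forall i, 0 < affine_form (g t i) (b t i) x].

Lemma sum_bisu (t : 'I_P) (x : 'cV[R]_d) :
  bisu (\sum_i bisu (affine_form (g t i) (b t i) x) + (- d%:R - 2^-1)) =
  (task_inside t x)%:R.
Proof.
rewrite (eq_bigr (fun i => (0 < affine_form (g t i) (b t i) x)%R%:R)); last first.
  by move=> i _; rewrite /bisu; case: ifP.
rewrite -natr_sum /bisu /task_inside; case: forallP => [in_t|nin_t].
  rewrite (eq_bigr (fun=> 1%N)) => [|i _]; last by rewrite in_t.
  by rewrite sum1_card card_ord ifT // -natr1; lra.
rewrite ifF //; apply/negbTE; rewrite -leNgt.
have [i nlam] : exists i, ~~ (0 < affine_form (g t i) (b t i) x).
  by apply: contrapT => all_lam; apply: nin_t => i; apply: contrapT => /negP ?;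
    apply: all_lam; exists i.
have : (\sum_i (0 < affine_form (g t i) (b t i) x)%R <= d)%N.
  rewrite (bigD1 i) //= (negbTE nlam) add0n.
  apply: (leq_trans (leq_sum _ (fun j _ => leq_b1 _))).
  by rewrite sum1_card cardC1 card_ord.
by rewrite -(ler_nat R); lra.
Qed.

Lemma relu_id (y : R) : 0 <= y -> relu y = y.
Proof. by move=> y0; rewrite /relu; apply/max_r. Qed.

Lemma relu_subr_opp (y : R) : relu y - relu (- y) = y.
Proof.
by rewrite /relu; case: (ltrgt0P y) => y0; rewrite ?maxEle; do ?case: ifP; lra.
Qed.

(** [y1], [y2], [y3] are the outputs of the first three hidden layers; the fourth returns [y3],
    which is nonnegative. The bound [C] makes the shifted values nonnegative in [E1] and [E2] and
    silences inactive tasks in [E3]. *)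
Lemma task_network_realization (x : 'cV[R]_d) (r : 'I_q) :
  (forall t j, `|(A t *m x + c t) j 0| <= C) ->
  realization task_network x r 0 =
    \sum_t \sum_j O r t j * ((task_inside t x)%:R * (A t *m x + c t) j 0).
Proof.
move=> boundC.
pose y1 (u : layer1) : R := match u.2 with
  | inl i => bisu (affine_form (g u.1 i) (b u.1 i) x)
  | inr j => (A u.1 *m x + c u.1) j 0 + C end.
pose y2 (u : layer2) : R :=
  if u.2 is Some j then (A u.1 *m x + c u.1) j 0 + C else (task_inside u.1 x)%:R.
pose y3 (u : layer3) : R :=
  (task_inside u.1.1 x)%:R * relu ((-1) ^+ u.2 * (A u.1.1 *m x + c u.1.1) u.1.2 0).
have AC_ge0 t j : 0 <= (A t *m x + c t) j 0 + C.
  by have := boundC t j; rewrite ler_norml => /andP[+ _]; lra.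
(* Kept apart from the other layers, as the input is a plain vector and not an [indexed_col]. *)
have E1 : \col_i tnth (indexed_tuple activation1) i
    ((\matrix_(u < #|layer1|, k < d) weight1 (enum_val u) k *m x +
      indexed_col bias1) i 0) =
    indexed_col y1.
  apply/colP => u; rewrite !mxE tnth_mktuple /y1 /activation1.
  under eq_bigr do rewrite mxE; rewrite /weight1 /bias1.
  case: (enum_val u) => t [i|j] /=.
    by rewrite /affine_form mxE.
  rewrite relu_id; first by rewrite !mxE addrA.
  by have := AC_ge0 t j; rewrite !mxE addrA.
have E2 : (fun u => activation2 u (\sum_u' weight2 u u' * y1 u' + bias2 u)) = y2.
  apply/funext => -[t o]; rewrite /weight2 (sum_block t (block2 o)) big_sumType /=.
  rewrite /activation2 /bias2 /y2 /y1; case: o => [j|] /=.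
    rewrite -mulr_sumr mul0r add0r addr0 (bigD1 j) //= eqxx mul1r.
    rewrite big1 => [|j' /negbTE ->]; last by rewrite mul0r.
    by rewrite addr0 relu_id.
  by rewrite -!mulr_sumr mul1r mul0r addr0 sum_bisu.
have E3 : (fun u => activation3 u (\sum_u' weight3 u u' * y2 u' + bias3 u)) = y3.
  apply/funext => -[[t j] s]; rewrite /weight3 (sum_block t (block3 j s)) big_option /=.
  rewrite (bigD1 j) //= eqxx big1 => [|j' /negbTE ->]; last by rewrite mul0r.
  rewrite /activation3 /bias3 /y2 /y3 /= addr0.
  have := boundC t j; set z := (A t *m x + c t) j 0 => zC.
  case: (task_inside t x) => /=.
    by rewrite mul1r; congr relu; ring.
  rewrite mul0r /relu; apply/max_l; rewrite mulr0.
  by move: zC; rewrite ler_norml => /andP[z1 z2]; case: s; rewrite ?expr0 ?expr1; lra.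
have y3_ge0 u : 0 <= y3 u.
  by rewrite mulr_ge0 ?ler0n // /relu le_max lexx.
have E4 : (fun u => activation3 u (\sum_u' weight4 u u' * y3 u' + 0)) = y3.
  apply/funext => u; rewrite (bigD1 u) //= /weight4 eqxx mul1r.
  rewrite big1 => [|u' /negbTE ->]; last by rewrite mul0r.
  by rewrite !addr0 /activation3 relu_id.
transitivity (realization
  (HiddenLayer (indexed_mx weight2) (indexed_col bias2)
    (indexed_tuple activation2)
  (HiddenLayer (indexed_mx weight3) (indexed_col bias3)
    (indexed_tuple activation3)
  (HiddenLayer (indexed_mx weight4) (indexed_col (fun=> 0))
    (indexed_tuple activation3)
  (OutputLayer (\matrix_(r < q, u < #|layer3|) output_weight r (enum_val u))
    0)))) (indexed_col y1) r 0).
  by rewrite -E1.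
rewrite indexed_hidden E2 indexed_hidden E3 indexed_hidden E4.
rewrite [LHS]/= mxE [X in _ + X]mxE addr0 mxE.
rewrite (eq_bigr (fun u => output_weight r (enum_val u) * y3 (enum_val u))); last first.
  by move=> u _; rewrite !mxE.
rewrite (sum_indexed (fun u => output_weight r u * y3 u)).
pose F (tj : 'I_P * 'I_d) (s : bool) : R :=
  (-1) ^+ s * O r tj.1 tj.2 * ((task_inside tj.1 x)%:R *
    relu ((-1) ^+ s * (A tj.1 *m x + c tj.1) tj.2 0)).
transitivity (\sum_tj \sum_s F tj s).
  by rewrite pair_bigA; apply: eq_bigr => -[].
rewrite [RHS]pair_bigA /=; apply: eq_bigr => -[t j] _ /=.
rewrite big_bool /F /= expr1 expr0 !mulN1r !mul1r.
by rewrite -[in RHS](relu_subr_opp ((A t *m x + c t) j 0)); ring.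
Qed.

Lemma size_task_network : (0 < d)%N ->
  (forall t j r r', O r t j != 0 -> O r' t j != 0 -> r = r') ->
  (nn_size task_network <= 21 * (P * d ^ 2))%N.
Proof.
move=> d0 O_inj.
have card1 : #|layer1| = (P * (d.+1 + d))%N by rewrite card_prod card_sum !card_ord.
have card2 : #|layer2| = (P * d.+1)%N by rewrite card_prod card_option !card_ord.
have card3 : #|layer3| = (P * d * 2)%N by rewrite !card_prod card_bool !card_ord.
have sumP (J : finType) (m : nat) (F : 'I_P * J -> nat) :
    (forall t, (\sum_j F (t, j) <= m)%N) -> (\sum_u F u <= P * m)%N.
  move=> Fm; rewrite (eq_bigr (fun u => F (u.1, u.2))); last by case.
  rewrite -(pair_bigA _ (fun t j => F (t, j))) /=.
  by apply: (leq_trans (leq_sum _ (fun t _ => Fm t))); rewrite sum_nat_const card_ord.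
have W1 := nnz_max (\matrix_(u < #|layer1|, k < d) weight1 (enum_val u) k).
have B1 := nnz_indexed_col bias1.
have W2 : (nnz (indexed_mx weight2) <= P * (d.+1 + d))%N.
  pose s (u : layer2) : seq layer1 := if u.2 is Some j then [:: (u.1, inr j)]
    else [seq (u.1, inl i) | i <- enum 'I_d.+1].
  apply: leq_trans (nnz_indexed_mx (s := s) _) _.
    move=> [t o] [t' u]; rewrite /weight2 /s /=.
    case: (t' =P t) => [->|_]; last by rewrite eqxx.
    case: o u => [j|] [i|j'] /=; [by rewrite eqxx| | |by rewrite eqxx].
      by case: (j' =P j) => [->|]; rewrite ?eqxx // inE eqxx.
    by move=> _; apply/mapP; exists i; rewrite ?mem_enum.
  apply: sumP => t; rewrite (@big_option nat) /= size_map size_enum_ord leq_add2l.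
  by rewrite sum_nat_const card_ord muln1.
have B2 := nnz_indexed_col bias2.
have W3 : (nnz (indexed_mx weight3) <= #|layer3| * 2)%N.
  apply: leq_trans (nnz_indexed_mx
    (s := fun u => [:: (u.1.1, None); (u.1.1, Some u.1.2)]) _) _.
    move=> [[t j] s] [t' [j'|]]; rewrite /weight3 /= !inE !xpair_eqE.
      by case: (t' == t); case: (j' =P j) => [->|_]; rewrite ?eqxx ?orbT.
    by case: (t' == t); rewrite ?eqxx.
  by rewrite /= sum_nat_const.
have B3 := nnz_indexed_col bias3.
have W4 : (nnz (indexed_mx weight4) <= #|layer3| * 1)%N.
  apply: leq_trans (nnz_indexed_mx (s := fun u => [:: u]) _) _.
    by move=> u u'; rewrite /weight4 inE; case: (u' =P u) => // _; rewrite eqxx.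
  by rewrite /= sum_nat_const.
have B4 : nnz (indexed_col (fun _ : layer3 => 0 : R)) = 0%N.
  by rewrite (_ : indexed_col _ = 0) ?nnz0 //; apply/colP => u; rewrite !mxE.
(* Counted by columns: each neuron of the last hidden layer feeds at most one output, by [O_inj]. *)
have W5 : (nnz (\matrix_(r < q, u < #|layer3|) output_weight r (enum_val u)) <=
    #|layer3| * 1)%N.
  pose s (u : 'I_#|layer3|) := [seq r <- enum 'I_q | output_weight r (enum_val u) != 0].
  apply: leq_trans (nnz_cols (s := s) _) _.
    by move=> r u; rewrite mxE mem_filter mem_enum => ->.
  rewrite -[X in (X * 1)%N]card_ord -sum_nat_const leq_sum // => u _.
  have : uniq (s u) by rewrite filter_uniq ?enum_uniq.
  have : {in s u &, forall r r', r = r'}.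
    move=> r r'; rewrite !mem_filter !mulf_eq0 !negb_or.
    by move=> /andP[/andP[_ Or] _] /andP[/andP[_ Or'] _]; exact: O_inj Or Or'.
  case: (s u) => [|r [|r' l]] //= rr'.
  by rewrite !inE (rr' r r') ?inE ?eqxx ?orbT.
rewrite /= B4 nnz0 !addn0.
apply: leq_trans (leq_add (leq_add W1 B1) (leq_add (leq_add W2 B2)
  (leq_add (leq_add W3 B3) (leq_add W4 W5)))) _.
(* Per task the bounds add up to 2 d^2 + 16 d + 3, which is at most 21 d^2; the quadratic term comes
   from the first layer alone. *)
by rewrite card1 card2 card3; nia.
Qed.

End TaskNetwork.

(** * Networks parametrised by coefficient vectors *)

Section AlmostEqual.
Variables (R : realType) (d : nat) (D : set 'cV[R]_d) (X : Type).
Implicit Types f g h : 'cV[R]_d -> X.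

Lemma ae_equal_refl f : ae_equal D f f.
Proof. exact: ae_on_true. Qed.

Lemma ae_equal_sym f g : ae_equal D f g -> ae_equal D g f.
Proof. by apply: ae_onS => x _ ->. Qed.

Lemma ae_equal_trans g f h : ae_equal D f g -> ae_equal D g h -> ae_equal D f h.
Proof. by apply: ae_onS2 => x _ -> ->. Qed.

End AlmostEqual.

Section CoordinateNetworks.
Variables (R : realType) (d q N : nat) (D : set 'cV[R]_d).
Variables (comb : 'cV[R]_N -> 'cV[R]_d -> 'cV[R]_q)
  (net : 'cV[R]_N -> network R q d).
Hypothesis combD : forall c a c' x,
  comb (c + a *: c') x = comb c x + a *: comb c' x.
Hypothesis comb_inj : forall c c', ae_equal D (comb c) (comb c') -> c = c'.
Hypothesis net_comb : forall c, ae_equal D (realization (net c)) (comb c).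
Variable V : set ('cV[R]_d -> 'cV[R]_q).
Hypothesis V_comb : forall v, V v <-> exists c, ae_equal D v (comb c).

Lemma comb0 x : comb 0 x = 0.
Proof.
have := combD 0 1 0 x; rewrite scaler0 addr0 scale1r => /eqP.
by rewrite eq_sym -subr_eq0 addrK => /eqP.
Qed.

Lemma comb_delta (c : 'cV[R]_N) x :
  comb c x = \sum_i c i 0 *: comb (delta_mx i 0) x.
Proof.
have -> : c = \sum_i c i 0 *: delta_mx i 0.
  rewrite {1}[c]matrix_sum_delta; apply: eq_bigr => i _.
  by rewrite big_ord1.
transitivity (\sum_i c i 0 *: comb (delta_mx i 0) x); last first.
  apply: eq_bigr => i _; congr (_ *: _).
  rewrite summxE (bigD1 i) //= !mxE !eqxx mulr1 big1 ?addr0 // => j /negbTE ji.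
  by rewrite !mxE eq_sym ji mulr0.
elim/big_rec2: _ => [|i y1 y2 _ <-]; first exact: comb0.
by rewrite addrC combD addrC.
Qed.

Lemma comb_has_dim : has_dim D V N.
Proof.
exists (fun i => comb (delta_mx i 0)); split=> [i|v /V_comb[c vc]].
  by apply/V_comb; exists (delta_mx i 0); exact: ae_equal_refl.
exists c; split; first by apply: ae_onS vc => x _ ->; exact: comb_delta.
move=> c' vc'; apply: comb_inj; apply: ae_equal_trans (ae_equal_sym vc) _.
by apply: ae_onS vc' => x _ ->; rewrite -comb_delta.
Qed.

(** The default 0 makes the map total. On [V] the choice is unique by [comb_inj], so it depends on
    the class of [v] almost everywhere only. *)
Definition coordinates (v : 'cV[R]_d -> 'cV[R]_q) : 'cV[R]_N :=
  xget 0 [set c | ae_equal D v (comb c)].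

Lemma coordinatesP v : V v -> ae_equal D v (comb (coordinates v)).
Proof. by move=> /V_comb; exact: (@xgetPex _ 0 [set c | ae_equal D v (comb c)]). Qed.

Lemma coordinates_uniq v c : ae_equal D v (comb c) -> coordinates v = c.
Proof.
move=> vc; have Vv : V v by apply/V_comb; exists c.
by apply: comb_inj; exact: ae_equal_trans (ae_equal_sym (coordinatesP Vv)) vc.
Qed.

Definition network_of (v : 'cV[R]_d -> 'cV[R]_q) : network R q d :=
  net (coordinates v).

Lemma network_of_realization v : V v -> ae_equal D (realization (network_of v)) v.
Proof.
by move=> Vv; exact: ae_equal_trans (net_comb _) (ae_equal_sym (coordinatesP Vv)).
Qed.

Lemma coordinates_ae v w : ae_equal D v w -> V w -> coordinates v = coordinates w.
Proof.
by move=> vw Vw; apply: coordinates_uniq; exact: ae_equal_trans vw (coordinatesP Vw).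
Qed.

Lemma network_of_comb c : network_of (comb c) = net c.
Proof. by congr net; apply: coordinates_uniq; exact: ae_equal_refl. Qed.

Lemma V_lin v w a : V v -> V w -> V (fun x => v x + a *: w x).
Proof.
move=> /coordinatesP vc /coordinatesP wc; apply/V_comb.
exists (coordinates v + a *: coordinates w).
by apply: ae_onS2 vc wc => x _ -> ->; rewrite combD.
Qed.

Lemma V_ae v w : ae_equal D v w -> V w -> V v.
Proof.
by move=> vw /V_comb[c wc]; apply/V_comb; exists c; exact: ae_equal_trans vw wc.
Qed.

(** The vector space is that of the coefficients, carried over by [net], which is injective because
    realizations determine coefficients. *)
Lemma network_of_vector_space : let NN := [set network_of v | v in V] in
  exists op,
    [/\ forall v w a, V v -> V w ->
          op (network_of v) a (network_of w) = network_of (fun x => v x + a *: w x),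
        vector_space_with NN op &
        linear_iso_with D NN op V (@realization R q d)].
Proof.
move=> NN.
(* The operation acts on networks, not on functions, so it recovers the functions from the
   realizations, up to null sets to which [coordinates] is blind. *)
pose op (Phi : network R q d) a Psi :=
  network_of (fun x => realization Phi x + a *: realization Psi x).
have opE v w a : V v -> V w ->
    op (network_of v) a (network_of w) = network_of (fun x => v x + a *: w x).
  move=> Vv Vw; congr net; apply: coordinates_ae; last exact: V_lin.
  by apply: ae_onS2 (network_of_realization Vv) (network_of_realization Vw) => x _ -> ->.
have V_c c : V (comb c) by apply/V_comb; exists c; exact: ae_equal_refl.
have net_inj : injective net.
  move=> c c' cc'; apply: comb_inj.
  by apply: ae_equal_trans (ae_equal_sym (net_comb c)) _; rewrite cc'.
exists op; split=> //.
- exists 'cV[R]_N, net; split=> //.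
    apply/seteqP; split=> [_ [c _ <-]|_ [v Vv <-]]; last by exists (coordinates v).
    by exists (comb c) => //; exact: network_of_comb.
  move=> c c' a; rewrite -(network_of_comb c) -(network_of_comb c') opE //.
  rewrite -network_of_comb; congr network_of; apply/funext => x.
  by rewrite combD.
- split.
  + by move=> _ [v Vv <-]; exact: V_ae (network_of_realization Vv) Vv.
  + move=> _ _ a [v Vv <-] [w Vw <-]; rewrite opE //.
    apply: ae_equal_trans (network_of_realization (V_lin a Vv Vw)) _.
    apply: ae_onS2 (network_of_realization Vv) (network_of_realization Vw) => x _ -> ->.
    by [].
  + move=> _ _ [v Vv <-] [w Vw <-] vw; congr net; apply: coordinates_ae => //.
    apply: ae_equal_trans (ae_equal_sym (network_of_realization Vv)) _.
    exact: ae_equal_trans vw (network_of_realization Vw).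
  + by move=> v Vv; exists (network_of v); [exists v|exact: network_of_realization].
Qed.

End CoordinateNetworks.

(** * Emulation of the shape functions *)

Lemma sum_tagged (V : nmodType) (I : finType) (J : I -> finType)
    (F : {i : I & J i} -> V) :
  \sum_t F t = \sum_i \sum_(j : J i) F (Tagged J j).
Proof.
by rewrite [RHS]sig_big_dep /=; apply: eq_bigr => -[].
Qed.

Lemma bounded_entries (R : realType) (d : nat) (D : set 'cV[R]_d) :
  bounded_set D -> exists M : R, forall x, D x -> forall k, `|x k 0| <= M.
Proof.
move=> /pinfty_ex_gt0[M M0 DM]; exists (M + 1) => x Dx k; apply/ltW.
have : ball (0 : 'cV[R]_d) (M + 1) x.
  rewrite -ball_normE /= sub0r normrN; apply: (le_lt_trans (DM _ Dx)).
  by rewrite ltrDl.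
by case=> _ /(_ k 0); rewrite /ball /= mxE sub0r normrN.
Qed.

Lemma affine_bounded (R : realType) (d p : nat) (I : finType) (D : set 'cV[R]_d)
    (A : I -> 'M[R]_(p, d)) (c : I -> 'cV[R]_p) : bounded_set D ->
  exists C : R, forall i j x, D x -> `|(A i *m x + c i) j 0| <= C.
Proof.
move=> /bounded_entries[M DM].
(* With the absolute value of [M], whose sign is unknown, all terms are nonnegative, and the sum
   over all i and j dominates each of them. *)
pose B i j := \sum_k `|A i j k| * `|M| + `|c i j 0|.
have B_ge0 i j : 0 <= B i j.
  by rewrite addr_ge0 // sumr_ge0 // => k _; rewrite mulr_ge0.
exists (\sum_i \sum_j B i j) => i j x Dx; apply: (@le_trans _ _ (B i j)).
  rewrite mxE (le_trans (ler_normD _ _)) // lerD2r mxE.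
  rewrite (le_trans (ler_norm_sum _ _ _)) // ler_sum // => k _.
  by rewrite normrM ler_wpM2l // (le_trans (DM x Dx k)) // ler_norm.
rewrite (bigD1 i) //= (bigD1 j) //= -addrA lerDl addr_ge0 //.
  by rewrite sumr_ge0.
by rewrite sumr_ge0 // => i' _; rewrite sumr_ge0.
Qed.

(** The number of components varies with the index; numbering entries by naturals, with value 0 out
    of range, avoids casts between dimensions. *)
Definition nat_entry (R : realType) (q : nat) (y : 'cV[R]_q) (m : nat) : R :=
  \sum_(j < q | j == m :> nat) y j 0.

Section NatEntry.
Variables (R : realType) (q : nat).
Implicit Types y : 'cV[R]_q.

Lemma nat_entry_ord y (j : 'I_q) : nat_entry y j = y j 0.
Proof.
rewrite /nat_entry (bigD1 j) //= big1 ?addr0 // => i /andP[/eqP ij].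
by rewrite (val_inj ij) eqxx.
Qed.

Lemma nat_entry_sum (I : finType) (a : I -> R) (F : I -> 'cV[R]_q) m :
  nat_entry (\sum_i a i *: F i) m = \sum_i a i * nat_entry (F i) m.
Proof.
rewrite /nat_entry; under eq_bigr do rewrite summxE.
rewrite exchange_big /=; apply: eq_bigr => i _.
by rewrite mulr_sumr; apply: eq_bigr => j _; rewrite mxE.
Qed.

Lemma nat_entry_pid y (d m : nat) : (q <= d)%N ->
  nat_entry ((pid_mx q : 'M[R]_(d, q)) *m y) m = nat_entry y m.
Proof.
move=> qd; rewrite /nat_entry; under eq_bigr do rewrite mxE.
rewrite exchange_big [RHS]big_mkcond /=; apply: eq_bigr => k _.
have kd : (k < d)%N := leq_trans (ltn_ord k) qd.
rewrite big_mkcond (bigD1 (Ordinal kd)) //= big1 ?addr0 => [|i ik].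
  by case: ifP => // _; rewrite mxE /= eqxx ltn_ord mul1r.
case: ifP => // _; rewrite mxE; case: eqP => [ik'|]; last by rewrite mul0r.
by case/eqP: ik; apply: val_inj.
Qed.

End NatEntry.

Section FiniteElementNetwork.
Variables (R : realType) (n : nat) (D : set 'cV[R]_n.+1)
  (T : {fset simplex R n.+1}).
Hypotheses (oD : open D) (bD : bounded_set D) (DT : triangulation D T).
Variables (v : simplex R n.+1 -> 'I_n.+2 -> 'cV[R]_n.+1)
  (g : simplex R n.+1 -> 'I_n.+2 -> 'rV[R]_n.+1)
  (b : simplex R n.+1 -> 'I_n.+2 -> R).
Hypothesis Tvgb : forall K, K \in T -> barycentric K (v K) (g K) (b K).
Variables (W : discretization R n.+1) (theta : shape_family R n.+1).
Hypothesis shapes : shape_functions D T W theta.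
Hypothesis W_sub : forall k : 'I_(nfactors W),
  (factor_index k `<=` shape_indices T (factor_kind k))%fset.
Local Notation simplex_of i := (val (tagged i)).

Lemma theta_local_rep (i : fe_index W) :
  exists Ac, local_rep D T g b (simplex_of i) (theta_at theta i) Ac.
Proof.
exact: (shape_local_rep DT Tvgb (kappa := factor_kind (tag i)) (shapes (tagged i))).
Qed.

Definition theta_rep (i : fe_index W) := projT1 (cid (theta_local_rep i)).

(* A task is to emulate one shape function on one element. *)
Definition task : finType := {i : fe_index W & elements T (simplex_of i)}.
Definition element (t : task) : simplex R n.+1 := val (tagged t).

Lemma card_task : #|task| = (\sum_(i : fe_index W) s_index T i)%N.
Proof.
rewrite card_tagged sumnE big_map big_enum /=; apply: eq_bigr => i _.
by rewrite -cardfE.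
Qed.

Lemma value_dim_le kappa : (value_dim n.+1 kappa <= n.+1)%N.
Proof. by case: kappa. Qed.

(** Zero rows pad every value to n+1 coordinates, so that scalar and vector-valued tasks occupy the
    same neurons. *)
Definition task_mx (t : task) : 'M[R]_n.+1 :=
  pid_mx (factor_dim W (tag (tag t))) *m (theta_rep (tag t) (element t)).1.
Definition task_col (t : task) : 'cV[R]_n.+1 :=
  pid_mx (factor_dim W (tag (tag t))) *m (theta_rep (tag t) (element t)).2.

Lemma task_bounded : exists C : R, forall t j x, D x ->
  `|(task_mx t *m x + task_col t) j 0| <= C.
Proof. exact: affine_bounded. Qed.

Definition task_bound : R := projT1 (cid task_bounded).

Section Outputs.
Variables (q : nat) (blk : 'I_q -> fe_index W -> bool) (cmp : 'I_q -> nat)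
  (coef : fe_index W -> R).

(** Common form of both networks: output [r] collects the component [cmp r] from the indices
    selected by [blk r]. Parallel emulation has one block per index, a finite element function one
    block per factor. *)
Definition fem_network : network R q n.+1 :=
  @task_network R n.+1 #|task| q
    (fun t => g (element (enum_val t))) (fun t => b (element (enum_val t)))
    (fun t => task_mx (enum_val t)) (fun t => task_col (enum_val t)) task_bound
    (fun r t j => if blk r (tag (enum_val t)) && (j == cmp r :> nat)
                  then coef (tag (enum_val t)) else 0).

Lemma fem_network_realization :
  ae_on D (fun x => forall r, realization fem_network x r 0 =
    \sum_(i | blk r i) coef i * nat_entry (theta_at theta i x) (cmp r)).
Proof.
have repP i : ae_on D (fun x => theta_at theta i x = \sum_(K : elements T (simplex_of i))
    (inside g b (val K) x)%:R *:
      ((theta_rep i (val K)).1 *m x + (theta_rep i (val K)).2)).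
  have rep_i : local_rep D T g b (simplex_of i) (theta_at theta i) (theta_rep i).
    by rewrite /theta_rep; case: cid.
  exact: (local_rep_sum DT Tvgb rep_i).
apply: ae_onS (ae_on_fin repP) => x Dx rep_x r.
rewrite task_network_realization => [|t j]; last first.
  exact: (projT2 (cid task_bounded)).
pose F (t : task) : R := \sum_(j < n.+1)
  (if blk r (tag t) && (j == cmp r :> nat) then coef (tag t) else 0) *
  ((inside g b (element t) x)%:R * (task_mx t *m x + task_col t) j 0).
rewrite (sum_indexed F).
rewrite sum_tagged.
rewrite [RHS]big_mkcond; apply: eq_bigr => i _; rewrite /F /=.
case: ifP => [blk_i|_]; last first.
  by rewrite big1 // => K _; rewrite big1 // => j _; rewrite mul0r.
rewrite rep_x nat_entry_sum mulr_sumr; apply: eq_bigr => K _.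
rewrite -(nat_entry_pid _ _ (value_dim_le (factor_kind (tag i)))) mulmxDr !mulmxA.
rewrite /nat_entry !mulr_sumr [RHS]big_mkcond; apply: eq_bigr => j _.
by rewrite /task_mx /task_col /=; case: ifP => _; rewrite ?mul0r.
Qed.

Lemma arch_fem_network : arch fem_network = task_arch R n.+1 #|task| q.
Proof. exact: arch_task_network. Qed.

Lemma size_fem_network :
  (forall i r r', blk r i -> blk r' i -> cmp r = cmp r' -> r = r') ->
  (nn_size fem_network <= 21 * ((\sum_(i : fe_index W) s_index T i) * n.+1 ^ 2))%N.
Proof.
move=> blk_inj; rewrite -card_task; apply: size_task_network => // t j r r'.
case: ifP => [/andP[ri /eqP jr]|]; last by rewrite eqxx.
case: ifP => [/andP[r'i /eqP jr'] _ _|]; last by rewrite eqxx.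
by apply: blk_inj ri r'i _; rewrite -jr.
Qed.

End Outputs.

Local Notation N := #|fe_index W|.

Definition index_of (k : 'I_(nfactors W)) (j : factor_index k) : fe_index W :=
  Tagged (fun k => factor_index k) j.

Definition combination (c : 'cV[R]_N) (x : 'cV[R]_n.+1) :
    'cV[R]_(\sum_(k < nfactors W) factor_dim W k) :=
  \mxcol_k \sum_(j : factor_index k)
    c (enum_rank (index_of j)) 0 *: theta (factor_kind k) (val j) x.

Lemma submxcol_combination c x k : submxcol (combination c x) k =
  \sum_(j : factor_index k)
    c (enum_rank (index_of j)) 0 *: theta (factor_kind k) (val j) x.
Proof. exact: mxcolK. Qed.

Lemma combinationD c a c' x :
  combination (c + a *: c') x = combination c x + a *: combination c' x.
Proof.
apply/mxcolP => k; rewrite submxcolD submxcol_combination.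
have -> : submxcol (a *: combination c' x) k = a *: submxcol (combination c' x) k.
  by apply/matrixP => i j; rewrite !mxE.
rewrite !submxcol_combination scaler_sumr -big_split; apply: eq_bigr => j _.
by rewrite !mxE scalerDl scalerA.
Qed.

Lemma combination_inj c c' :
  ae_equal D (combination c) (combination c') -> c = c'.
Proof.
move=> cc'; apply/colP => r; rewrite -(enum_valK r); case: (enum_val r) => k j.
apply/eqP; rewrite -subr_eq0; apply/eqP.
apply: (shapes_independent oD DT Tvgb (W_sub k) (f := theta (factor_kind k))
  (c := fun j => c (enum_rank (index_of j)) 0 - c' (enum_rank (index_of j)) 0)).
  exact: shapes.
apply: ae_onS cc' => x _ /(congr1 (fun y => submxcol y k)).
rewrite !submxcol_combination => /eqP; rewrite -subr_eq0 => /eqP {2}<-.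
by rewrite -sumrB; apply: eq_bigr => i _; rewrite scalerBl.
Qed.

Lemma fe_spaceP (u : product_function W) :
  fe_space D W theta u <-> exists c, ae_equal D u (combination c).
Proof.
split=> [[c uc]|[c uc]].
  exists (\col_i c (enum_val i)); apply: ae_onS (ae_on_fin uc) => x _ ux.
  apply/mxcolP => k; rewrite submxcol_combination ux.
  by apply: eq_bigr => j _; rewrite mxE enum_rankK.
exists (fun i => c (enum_rank i) 0) => k; apply: ae_onS uc => x _ ->.
exact: submxcol_combination.
Qed.

(** [tagnat.sig1] and [tagnat.sig2] give the block of an output coordinate and its position in that
    block. *)
Definition shape_block (r : 'I_(\sum_(r < N) index_dim W r)) (i : fe_index W) :
    bool := enum_val (tagnat.sig1 r) == i.

Definition shape_network : network R (\sum_(r < N) index_dim W r) n.+1 :=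
  fem_network shape_block (fun r => tagnat.sig2 r) (fun=> 1).

Lemma shape_network_realization (r : 'I_N) : ae_on D (fun x =>
  submxcol (realization shape_network x) r = theta_at theta (enum_val r) x).
Proof.
apply: ae_onS (fem_network_realization shape_block
    (fun r => tagnat.sig2 r) (fun=> 1)) => x _ net_x.
apply/colP => j; rewrite mxE net_x.
rewrite (big_pred1 (enum_val r)) => [|i]; last first.
  by rewrite /shape_block tagnat.Rank1K eq_sym.
by rewrite mul1r tagnat.Rank2K -nat_entry_ord.
Qed.

Definition factor_block (r : 'I_(\sum_(k < nfactors W) factor_dim W k))
    (i : fe_index W) : bool := tagnat.sig1 r == tag i.

Definition combination_network (c : 'cV[R]_N) :
    network R (\sum_(k < nfactors W) factor_dim W k) n.+1 :=
  fem_network factor_block (fun r => tagnat.sig2 r)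
    (fun i => c (enum_rank i) 0).

Lemma combination_network_realization c :
  ae_equal D (realization (combination_network c)) (combination c).
Proof.
apply: ae_onS (fem_network_realization factor_block
  (fun r => tagnat.sig2 r) (fun i => c (enum_rank i) 0)) => x _ net_x.
apply/mxcolP => k; rewrite submxcol_combination; apply/colP => j.
rewrite mxE net_x tagnat.Rank2K summxE /=.
rewrite (eq_bigl (fun i => k == tag i)) => [|i]; last first.
  by rewrite /factor_block tagnat.Rank1K.
rewrite big_mkcond sum_tagged (bigD1 k) //= [X in _ + X]big1 ?addr0; last first.
  by move=> k' kk'; rewrite big1 // => i _; rewrite eq_sym (negbTE kk').
apply: eq_bigr => i _; rewrite eqxx [RHS]mxE; congr (_ * _).
exact: (nat_entry_ord (theta_at theta (index_of i) x)).
Qed.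

(** Together with an index [i0], this provides a task and hence positive layer dimensions. *)
Lemma sharing_gt0 (i : fe_index W) : (0 < s_index T i)%N.
Proof.
have ST : simplex_of i \in shape_indices T (factor_kind (tag i)).
  by apply: (fsubsetP (W_sub (tag i))); exact: fsvalP.
have [r {}ST] : exists r, simplex_of i \in subsimplices T r.
  by move: ST; case: (factor_kind _) => ST; eexists; exact: ST.
have [K KT [SK _]] := subsimplices_sub ST.
rewrite /s_index /sharing cardfs_gt0; apply/fset0Pn; exists K.
by rewrite !inE /= KT; apply/asboolP; exact: hull_mono.
Qed.

Lemma fem_size_bound M :
  (M <= 21 * ((\sum_(i : fe_index W) s_index T i) * n.+1 ^ 2))%N ->
  size_bound T W N (21 : R) M.
Proof.
move=> leM; split.
  rewrite -mulrA [n.+1%:R ^+ 2 * _]mulrC -natrX -!natrM ler_nat.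
  exact: leM.
rewrite -[leRHS]mulrA ler_wpM2l ?mulr_ge0 ?exprn_ge0 ?ler0n // -natrM ler_nat.
rewrite mulnC -sum_nat_const; apply: leq_sum => i _.
exact: leq_bigmax.
Qed.

Lemma shape_network_spec (i0 : fe_index W) :
  [/\ relu_bisu_network shape_network,
      forall r : 'I_N, ae_on D (fun x => submxcol (realization shape_network x) r =
        theta_at theta (enum_val r) x),
      depth shape_network = 5%N,
      size_bound T W N (21 : R) (nn_size shape_network) &
      arch shape_network = task_arch R n.+1 (\sum_(i : fe_index W) s_index T i)
        (\sum_(r < N) index_dim W r)].
Proof.
split.
- apply: relu_bisu_task_network => //.
    by rewrite card_task (bigD1 i0) //= addn_gt0 sharing_gt0.
  rewrite (bigD1 (enum_rank i0)) //= addn_gt0 /index_dim /factor_dim.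
  by case: factor_kind.
- exact: shape_network_realization.
- by [].
- apply/fem_size_bound/size_fem_network => i r r' /eqP ri /eqP r'i cmp_r.
  have rr' : tagnat.sig1 r = tagnat.sig1 r' by apply: enum_val_inj; rewrite ri.
  (* An output coordinate is determined by its block and its position there. *)
  by apply: val_inj; rewrite /= tagnat.rect [RHS]tagnat.rect cmp_r rr'.
- by rewrite arch_fem_network card_task.
Qed.

Lemma combination_network_spec (i0 : fe_index W) c :
  [/\ relu_bisu_network (combination_network c),
      depth (combination_network c) = 5%N,
      size_bound T W N (21 : R) (nn_size (combination_network c)) &
      arch (combination_network c) =
        task_arch R n.+1 (\sum_(i : fe_index W) s_index T i)
          (\sum_(k < nfactors W) factor_dim W k)].
Proof.
split.
- apply: relu_bisu_task_network => //.
    by rewrite card_task (bigD1 i0) //= addn_gt0 sharing_gt0.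
  by rewrite (bigD1 (tag i0)) //= addn_gt0 /factor_dim; case: factor_kind.
- by [].
- apply/fem_size_bound/size_fem_network => i r r' /eqP ri /eqP r'i cmp_r.
  have rr' : tagnat.sig1 r = tagnat.sig1 r' by rewrite ri.
  by apply: val_inj; rewrite /= tagnat.rect [RHS]tagnat.rect cmp_r rr'.
- by rewrite arch_fem_network card_task.
Qed.

End FiniteElementNetwork.

(** * Dependence of the architecture on the sharing numbers *)

Section Profile.
Variables (R : realType) (d : nat) (T : {fset simplex R d})
  (W : discretization R d).

Lemma size_s_profile : size (s_profile T W) = nfactors W.
Proof. by rewrite size_map size_enum_ord. Qed.

Lemma nth_s_profile (k : 'I_(nfactors W)) : nth [::] (s_profile T W) k =
  sort leq [seq sharing T j | j <- enum_fset (factor_index k)].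
Proof. by rewrite (nth_map k) ?size_enum_ord // nth_ord_enum. Qed.

(** Reads the number of tasks off the profile; sorting does not affect sums. *)
Lemma sumn_s_profile :
  sumn [seq sumn s | s <- s_profile T W] = (\sum_(i : fe_index W) s_index T i)%N.
Proof.
rewrite (@sum_tagged nat) -map_comp sumnE big_map big_enum /=.
apply: eq_bigr => k _; rewrite (perm_sumn (permEl (perm_sort _ _))).
by rewrite sumnE big_map big_seq_fsetE.
Qed.

Lemma index_dim_s_profile :
  (\sum_(r < #|fe_index W|) index_dim W r =
   \sum_(k < nfactors W) size (nth [::] (s_profile T W) k) * factor_dim W k)%N.
Proof.
rewrite /index_dim -(@big_enum_val _ _ _ (fe_index W) (fe_index W)
  (fun i => factor_dim W (tag i))) (@sum_tagged nat) /=.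
apply: eq_bigr => k _; rewrite nth_s_profile size_sort size_map sum_nat_const.
by rewrite -cardfE.
Qed.

End Profile.

Lemma fsubset_card (K : choiceType) (A : {fset K}) (m : nat) :
  (m <= #|` A|)%N -> exists2 S, (S `<=` A)%fset & #|` S| = m.
Proof.
move=> mA; exists [fset x in take m (enum_fset A)]%fset.
  by apply/fsubsetP => x; rewrite inE => /mem_take.
by rewrite card_fseq undup_id ?take_uniq ?fset_uniq // size_takel.
Qed.

Lemma shape_indices_neq0 (R : realType) (n : nat) (T : {fset simplex R n.+1})
    (K : simplex R n.+1) (kappa : fe_kind) :
  (0 < n)%N -> K \in T -> #|` K| = n.+2 -> shape_indices T kappa != fset0.
Proof.
move=> n0 KT cardK.
have sub_neq0 r : (r <= n.+1)%N -> subsimplices T r != fset0.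
  move=> rn; have [S SK cardS] : exists2 S, (S `<=` K)%fset & #|` S| = r.+1.
    by apply: fsubset_card; rewrite cardK.
  by apply/fset0Pn; exists S; apply/subsimplicesP; exists K.
by case: kappa; apply: sub_neq0.
Qed.

(** The architecture functions are fixed before any triangulation, so the kinds of the factors are
    restated in terms of d, the label and a natural number. *)
Definition kind_of (d : nat) (l : space_label) (k : nat) : fe_kind :=
  match l with
  | V1 => if k == 0%N then S1 else RT0
  | V2 => if (k < d)%N then S1 else RT0
  | V3 => N0
  | V4 => S1
  end.

Section VSpace.
Variables (R : realType) (n : nat) (D : set 'cV[R]_n.+1)
  (T : {fset simplex R n.+1}) (l : space_label) (Tf : R) (G : set 'cV[R]_n).
Local Notation W := (V_space D T l Tf G).

Lemma factor_kind_V_space (k : 'I_(nfactors W)) :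
  factor_kind k = kind_of n.+1 l k.
Proof. by case: l k. Qed.

Lemma meeting_sub (A : set 'cV[R]_n.+1) (J : {fset simplex R n.+1}) :
  (meeting A J `<=` J)%fset.
Proof. by apply/fsubsetP => S; rewrite !inE => /andP[]. Qed.

Lemma factor_index_V_space (k : 'I_(nfactors W)) :
  (factor_index k `<=` shape_indices T (factor_kind k))%fset.
Proof.
by case: l k => k /=; case: ifP => _ //=; exact: meeting_sub.
Qed.

(** A factor with boundary conditions may have no index at all, but each product has one without
    them, indexed by all vertices, faces or edges. *)
Lemma fe_index_V_space (K : simplex R n.+1) :
  (0 < n)%N -> K \in T -> #|` K| = n.+2 -> inhabited (fe_index W).
Proof.
move=> n0 KT cardK.
have [k kP] : exists k : 'I_(nfactors W),
    factor_index k = shape_indices T (factor_kind k).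
  case: l => /=.
  - by exists (inord 1); rewrite inordK.
  - have n2 : (n.+1 < 2 * n.+1)%N by lia.
    by exists (Ordinal n2); rewrite /= ltnn.
  - by exists (inord 1); rewrite inordK.
  - by exists ord_max; rewrite /= gtn_eqF.
have /fset0Pn[S] := shape_indices_neq0 (factor_kind k) n0 KT cardK.
by rewrite -kP => Sk; split; exists k; exists S.
Qed.

End VSpace.

Theorem proposition4p9 (R : realType) :
  exists (C : R)
    (arch_shape arch_fun :
       nat -> space_label -> seq (seq nat) -> nat -> architecture R),
  0 < C /\
  forall (n : nat) (D : set 'cV[R]_n.+1),
    (2 <= n.+1)%N -> polytopal_domain D ->
  forall T : {fset simplex R n.+1}, triangulation D T ->
  forall (l : space_label) (Tf : R) (G : set 'cV[R]_n), admissible D l Tf G ->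
  let W := V_space D T l Tf G in
  forall theta : shape_family R n.+1, shape_functions D T W theta ->
  exists dimW : nat,
  [/\ has_dim D (fe_space D W theta) dimW,
      #|fe_index W| = dimW,
      exists Phi : network R (\sum_(r < #|fe_index W|) index_dim W r) n.+1,
        [/\ relu_bisu_network Phi,
            forall r : 'I_#|fe_index W|,
              ae_on D (fun x =>
                submxcol (realization Phi x) r = theta_at theta (enum_val r) x),
            depth Phi = 5%N,
            size_bound T W dimW C (nn_size Phi) &
            arch Phi = arch_shape n.+1 l (s_profile T W) dimW] &
      l <> V4 ->
      exists PhiV : product_function W ->
                    network R (\sum_(k < nfactors W) factor_dim W k) n.+1,
        [/\ forall v, fe_space D W theta v ->
              [/\ relu_bisu_network (PhiV v),
                  forall k : 'I_(nfactors W),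
                    ae_on D (fun x =>
                      submxcol (realization (PhiV v) x) k = submxcol (v x) k),
                  depth (PhiV v) = 5%N,
                  size_bound T W dimW C (nn_size (PhiV v)) &
                  arch (PhiV v) = arch_fun n.+1 l (s_profile T W) dimW],
            forall v w, fe_space D W theta v -> fe_space D W theta w ->
              ae_equal D v w -> PhiV v = PhiV w &
            let NN := [set PhiV v | v in fe_space D W theta] in
            exists op,
              [/\ forall v w c, fe_space D W theta v -> fe_space D W theta w ->
                    op (PhiV v) c (PhiV w) = PhiV (fun x => v x + c *: w x),
                  vector_space_with NN op &
                  linear_iso_with D NN op (fe_space D W theta)
                    (@realization R _ n.+1)]]].

Proof.
(* Output dimensions in terms of the permitted data: each factor contributes its value dimension,
   once per shape function in [out_shape] and once in [out_fun]. *)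
pose out_shape d l (pr : seq (seq nat)) :=
  (\sum_(0 <= k < size pr) size (nth [::] pr k) * value_dim d (kind_of d l k))%N.
pose out_fun d l (pr : seq (seq nat)) :=
  (\sum_(0 <= k < size pr) value_dim d (kind_of d l k))%N.
exists 21, (fun d l pr _ =>
    task_arch R d (sumn [seq sumn s | s <- pr]) (out_shape d l pr)),
  (fun d l pr _ =>
    task_arch R d (sumn [seq sumn s | s <- pr]) (out_fun d l pr)).
split=> // n D n2 [oD _ [x0 Dx0] bD _] T DT l Tf G _ W theta shapes.
have [Tsimp DK _ _] := DT.
have coords K : exists vgb : ('I_n.+2 -> 'cV[R]_n.+1) * ('I_n.+2 -> 'rV[R]_n.+1) *
    ('I_n.+2 -> R), K \in T -> barycentric K vgb.1.1 vgb.1.2 vgb.2.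
  (* Dummy values outside [T] let [choice] define the coordinates on all simplices. *)
  have [KT|KT] := boolP (K \in T); last by exists (fun=> 0, fun=> 0, fun=> 0).
  have [cardK indepK] := Tsimp K KT.
  by have [v [g [b bK]]] := barycentric_exists cardK indepK; exists (v, g, b).
have [vgb Tvgb] := choice coords.
have W_sub : forall k : 'I_(nfactors W),
    (factor_index k `<=` shape_indices T (factor_kind k))%fset.
  exact: factor_index_V_space.
(* A point of [D] lies in some element, so [T] is not empty. *)
have [i0] : inhabited (fe_index W).
  have : closure D x0 by exact: subset_closure.
  rewrite DK => -[K KT _]; have [cardK _] := Tsimp K KT.
  exact: fe_index_V_space n2 KT cardK.
have out_shapeE : (\sum_(r < #|fe_index W|) index_dim W r =
    out_shape n.+1 l (s_profile T W))%N.
  rewrite (index_dim_s_profile T) /out_shape size_s_profile big_mkord.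
  by apply: eq_bigr => k _; rewrite /factor_dim factor_kind_V_space.
have out_funE : (\sum_(k < nfactors W) factor_dim W k =
    out_fun n.+1 l (s_profile T W))%N.
  rewrite /out_fun size_s_profile big_mkord.
  by apply: eq_bigr => k _; rewrite /factor_dim factor_kind_V_space.
have comb_inj := combination_inj oD DT Tvgb shapes W_sub.
have net_comb := combination_network_realization bD DT Tvgb shapes.
have combD := @combinationD R n W theta.
have V_comb := @fe_spaceP R n D W theta.
exists #|fe_index W|; split=> //.
- exact: (comb_has_dim combD comb_inj V_comb).
- exists (shape_network bD DT Tvgb shapes).
  rewrite sumn_s_profile -out_shapeE.
  exact: shape_network_spec.
move=> _; exists (network_of D (@combination _ _ W theta)
  (combination_network bD DT Tvgb shapes)); split.
- move=> v Vv.
  have [? ? ? archE] := combination_network_spec bD DT Tvgb shapes W_sub i0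
    (coordinates D (@combination _ _ W theta) v).
  split=> //; last by rewrite sumn_s_profile -out_funE.
  move=> k; have := network_of_realization net_comb V_comb Vv.
  by apply: ae_onS => x _ ->.
- move=> v w Vv Vw vw; congr combination_network.
  exact: (coordinates_ae comb_inj V_comb vw Vw).
- exact: (network_of_vector_space combD comb_inj net_comb V_comb).
Qed.
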